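(* Let $b>c$ be positive integers and $r,s$ positive integers, and let $\lambda=(b+c,b^r,c^s)$ (one part equal to $b+c$, $r$ parts equal to $b$, $s$ parts equal to $c$), a partition of $n=b+c+rb+sc$. Then $X_\lambda$ is not Cohen--Macaulay.
   Context: Work over $\mathbb{C}$. For a partition $\lambda=(\lambda_1\ge\dots\ge\lambda_r)$ of $n$, let $E_\lambda\subset\mathbb{C}^n$ be the subspace defined by $x_1=\cdots=x_{\lambda_1}$, $x_{\lambda_1+1}=\cdots=x_{\lambda_1+\lambda_2}$, ..., $x_{n-\lambda_r+1}=\cdots=x_n$. Let $X_\lambda=S_n\cdot E_\lambda$ be the union of the $S_n$-translates of $E_\lambda$ (a reduced subspace arrangement in $\mathbb{C}^n$). *)

(* Defs.v *)
From HB Require Import structures.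
From mathcomp Require Import all_boot all_algebra all_fingroup.
From mathcomp Require Import reals complex.
From mathcomp Require Import mpoly.
Set Implicit Arguments. Unset Strict Implicit. Unset Printing Implicit Defensive.
Import GRing.Theory.
Local Open Scope ring_scope.

(* index (0-based) of the block of lambda containing the coordinate i (0-based);
   blocks are consecutive: the first lambda_1 coordinates, the next lambda_2, ... *)
Fixpoint blk (l : seq nat) (i : nat) : nat :=
  match l with
  | [::] => 0%N
  | a :: l' => if (i < a)%N then 0%N else (blk l' (i - a)).+1
  end.

Definition E_lambda (C : Type) (n : nat) (l : seq nat) (x : 'I_n -> C) : Prop :=
  forall i j : 'I_n, blk l i = blk l j -> x i = x j.

Definition X_lambda (C : Type) (n : nat) (l : seq nat) (x : 'I_n -> C) : Prop :=
  exists (sigma : 'S_n) (y : 'I_n -> C), E_lambda l y /\ forall i, x i = y (sigma i).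

Definition vanishing_ideal (C : comNzRingType) (n : nat) (X : ('I_n -> C) -> Prop)
  (p : {mpoly C[n]}) : Prop :=
  forall x, X x -> p.@[x] = 0.

Section CA.
Variables (C : comNzRingType) (n : nat).
Notation S := {mpoly C[n]}.

Definition is_ideal (P : S -> Prop) : Prop :=
  [/\ P 0, (forall x y, P x -> P y -> P (x + y)) & (forall a x, P x -> P (a * x))].

Definition is_prime (P : S -> Prop) : Prop :=
  [/\ is_ideal P, ~ P 1 & forall x y, P (x * y) -> P x \/ P y].

Definition in_sum_ideal (I : S -> Prop) (fs : seq S) (p : S) : Prop :=
  exists q (gs : seq S), I q /\ size gs = size fs /\
    p = q + \sum_(i < size fs) gs`_i * fs`_i.

(* Krull dimension of S/I is exactly d: chains of primes of S containing I
   (= chains of primes of S/I) have length at most d, and one has length d *)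
Definition chain_above (I : S -> Prop) (d : nat) : Prop :=
  exists P : nat -> S -> Prop,
    (forall k, (k <= d)%N -> is_prime (P k) /\ (forall p, I p -> P k p)) /\
    (forall k, (k < d)%N ->
       (forall p, P k p -> P k.+1 p) /\ exists p, P k.+1 p /\ ~ P k p).

Definition krull_dim_quot (I : S -> Prop) (d : nat) : Prop :=
  chain_above I d /\ forall e, chain_above I e -> (e <= d)%N.

Definition in_irrelevant (p : S) : Prop := p@_0%MM = 0.

Definition regular_seq (I : S -> Prop) (fs : seq S) : Prop :=
  ~ in_sum_ideal I fs 1 /\
  forall k, (k < size fs)%N -> forall g,
    in_sum_ideal I (take k fs) (fs`_k * g) -> in_sum_ideal I (take k fs) g.

(* S/I (I homogeneous) is Cohen--Macaulay: depth of its maximal homogeneous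
   ideal m (= grade of m, max length of a regular sequence in m) equals dim S/I *)
Definition cohen_macaulay_quot (I : S -> Prop) : Prop :=
  exists d, krull_dim_quot I d /\
    exists fs : seq S, size fs = d /\ (forall f, f \in fs -> in_irrelevant f)
                       /\ regular_seq I fs.
End CA.

Definition arrangement_CM (C : comNzRingType) (n : nat) (X : ('I_n -> C) -> Prop) : Prop :=
  cohen_macaulay_quot (vanishing_ideal X).

Definition lambda_bcrs (b c r s : nat) : seq nat :=
  (b + c)%N :: nseq r b ++ nseq s c.

(* Main.v *)
Require Import Defs.
From HB Require Import structures.
From mathcomp Require Import all_boot all_order all_algebra all_fingroup.
From mathcomp Require Import reals complex.
From mathcomp Require Import mpoly.
From mathcomp Require Import ring zify.
From Stdlib Require Import Classical.
(**
 Write [N = b + c], and let [W] be the stratum where the block of size [N], one block of size [b] and one of size [c] take the same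
 value; it has codimension 2 in [X_lambda]. If [X_lambda] were Cohen-Macaulay, every section of the structure sheaf off [W] would
 extend (vanishing of [H^1] of the Koszul complex on linear equations of [W], obtained from the regular sequence by graded Nakayama).

 Near [W] only the set partitions of a fixed set [D] of [2N] coordinates into blocks [A], [B], [E] of sizes [N], [b], [c] matter.
 Mark [o] in [D] and, with values [z], [u], [v] on the blocks and [phi = (z - u)^2 (z - v)^2 (u - v)], take the section equal to [0],
 [c * phi] or [- b * phi] according to whether [o] lies in [A], [B] or [E]. It is locally polynomial wherever the three values are not
 all equal: when two blocks merge, [phi] vanishes to first or second order and the local ring is a cusp or a pair of tangent parabolas.
 It does not extend over [W]: averaging an extension over the permutations of [D] fixing [o], one could take a
 quintic in [x_o] and the power sums, and comparing coefficients gives [3 b^2 + 10 b c + 3 c^2 = 0].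
*)

(** The weights [c] and [- b] come from centring: on [B :|: E] the coordinate [x_o] minus the mean
    of the block, multiplied by [b + c], takes the values [c * (u - v)] and [- b * (u - v)]. The
    section is this centred coordinate times [(z - u)^2 (z - v)^2] off [A], and zero on [A]. The
    section has different polynomial formulas on different open sets, and the other components of
    [X_lambda] are invisible only where [sepq] is nonzero. Both obstacles are absorbed by
    [ext_ideal], the ideal of multipliers [m] such that [m] times the section extends after
    inverting [sepq]. It contains a power of each linear equation [l] of [W], and it is proper.
    Hence some [m] outside it satisfies [l * m] in it for every [l]; the extensions of [l * m] times
    the section form a Koszul 1-cocycle, and vanishing of [H^1] puts [m] into the ideal, a
    contradiction. Properness is tested by scaling towards a point of [W]: as [phi] has degree 5,
    the coefficient of [t^5] isolates a quintic from an arbitrary extension. *)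

Set Implicit Arguments. Unset Strict Implicit. Unset Printing Implicit Defensive.
Import Order.TTheory GRing.Theory Num.Theory.
Local Open Scope ring_scope.

(** * Koszul cohomology and depth *)

Section Koszul.
Variable S : comNzRingType.
Implicit Types (P : S -> Prop) (ys : seq S) (y t a : S).

Definition ideal_like P :=
  [/\ P 0, forall x y, P x -> P y -> P (x + y) & forall a x, P x -> P (a * x)].

(** In a pair the second entry is the coefficient of the exterior generator of [y]; hence the sign
    in [koszul_d] and the degree shift in [koszul_deg]. *)
Fixpoint koszul ys : lmodType S :=
  if ys is _ :: ys' then (koszul ys' * koszul ys')%type else S^o.

Fixpoint koszul_d ys : koszul ys -> koszul ys :=
  match ys with
  | [::] => fun _ => 0
  | y :: ys' => fun u => (koszul_d u.1, y *: u.1 - koszul_d u.2)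
  end.

Fixpoint koszul_in P ys : koszul ys -> Prop :=
  match ys with
  | [::] => fun u => P u
  | _ :: ys' => fun u => koszul_in P u.1 /\ koszul_in P u.2
  end.

(* Shifted by one: [koszul_deg i.+1] is cohomological degree [i], so that [koszul_deg 0] can say that
   a cochain of degree -1 vanishes. *)
Fixpoint koszul_deg ys (i : nat) : koszul ys -> Prop :=
  match ys with
  | [::] => fun u => i = 1%N \/ u = 0
  | _ :: ys' => fun u => koszul_deg i u.1 /\ koszul_deg i.-1 u.2
  end.

(** Contraction against the [k]-th exterior generator: the homotopy between multiplication by the
    [k]-th element and zero. *)
Fixpoint koszul_h ys (k : nat) : koszul ys -> koszul ys :=
  match ys with
  | [::] => fun _ => 0
  | y :: ys' => fun u => if k is k'.+1 then (koszul_h k' u.1, - koszul_h k' u.2) else (u.2, 0)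
  end.

Fixpoint koszul_map (f : S -> S) ys : koszul ys -> koszul ys :=
  match ys with
  | [::] => fun u => f u
  | y :: ys' => fun u => (koszul_map f u.1, koszul_map f u.2)
  end.

Lemma kd_lin ys : linear (@koszul_d ys).
Proof.
elim: ys => [|y ys IH] a u v /=; first by rewrite scaler0 addr0.
rewrite !IH; congr pair; rewrite /= scalerDr !scalerA mulrC opprD scalerBr -!scalerA.
by rewrite addrACA scalerA.
Qed.
HB.instance Definition _ ys := GRing.isLinear.Build S (koszul ys) (koszul ys) _ (@koszul_d ys) (@kd_lin ys).

Lemma kdB ys (u v : koszul ys) : koszul_d (u - v) = koszul_d u - koszul_d v. Proof. exact: linearB. Qed.
Lemma kdZ ys a (u : koszul ys) : koszul_d (a *: u) = a *: koszul_d u. Proof. exact: linearZ. Qed.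

Lemma kh_lin ys k : linear (@koszul_h ys k).
Proof.
elim: ys k => [|y ys IH] k a u v /=; first by rewrite scaler0 addr0.
case: k => [|k]; first by congr pair; rewrite /= scaler0 addr0.
by rewrite !IH; congr pair; rewrite /= opprD scalerN.
Qed.
HB.instance Definition _ ys k := GRing.isLinear.Build S (koszul ys) (koszul ys) _ (@koszul_h ys k) (@kh_lin ys k).

Lemma kdd ys (u : koszul ys) : koszul_d (koszul_d u) = 0.
Proof.
elim: ys u => [//|y ys IH] [u1 u2] /=; rewrite IH linearB /= linearZ /= IH subr0 subrr //.
Qed.

Lemma kdh ys k (u : koszul ys) : (k < size ys)%N ->
  koszul_d (koszul_h k u) + koszul_h k (koszul_d u) = ys`_k *: u.
Proof.
elim: ys k u => [//|y ys IH] [|k] [u1 u2] /= hk.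
  by congr pair; rewrite /= ?linear0 ?subr0 ?addr0 ?[RHS]//= addrC subrK.
rewrite ltnS in hk.
congr pair => /=; first by rewrite IH.
rewrite -(IH k u2 hk) linearB /= linearZ /= !linearN /= opprK opprB.
rewrite [X in X + _]addrC -!addrA; congr (_ + _).
by rewrite addrC subrK.
Qed.

Section Ideal.
Variable P : S -> Prop.
Hypothesis idP : ideal_like P.

Lemma kP0 ys : koszul_in P (0 : koszul ys).
Proof. by case: idP => P0 _ _; elim: ys => [|y ys IH] //=. Qed.

Lemma kPD ys (u v : koszul ys) : koszul_in P u -> koszul_in P v -> koszul_in P (u + v).
Proof.
case: idP => _ PD _; elim: ys u v => [|y ys IH] /=; first by move=> u v; apply: PD.
by move=> [u1 u2] [v1 v2] [/= a1 a2] [/= b1 b2]; split; apply: IH.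
Qed.

Lemma kPZ ys a (u : koszul ys) : koszul_in P u -> koszul_in P (a *: u).
Proof.
case: idP => _ _ PM; elim: ys u => [|y ys IH] /=; first by move=> u; apply: PM.
by move=> [u1 u2] [/= a1 a2]; split; apply: IH.
Qed.

Lemma kPN ys (u : koszul ys) : koszul_in P u -> koszul_in P (- u).
Proof. by rewrite -scaleN1r; apply: kPZ. Qed.

Lemma kPB ys (u v : koszul ys) : koszul_in P u -> koszul_in P v -> koszul_in P (u - v).
Proof. by move=> hu hv; apply: kPD => //; apply: kPN. Qed.

Lemma kPd ys (u : koszul ys) : koszul_in P u -> koszul_in P (koszul_d u).
Proof.
elim: ys u => [|y ys IH] //=; first by move=> *; case: idP.
move=> [u1 u2] [/= a1 a2]; split; first exact: IH.
by apply: kPB; [apply: kPZ | apply: IH].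
Qed.

Lemma kPh ys k (u : koszul ys) : koszul_in P u -> koszul_in P (koszul_h k u).
Proof.
elim: ys k u => [|y ys IH] k //=; first by move=> *; case: idP.
move=> [u1 u2] [/= a1 a2]; case: k => [|k] /=; first by split=> //; apply: kP0.
by split; [apply: IH | apply: kPN; apply: IH].
Qed.

End Ideal.

Lemma dg_zero ys (u : koszul ys) : koszul_deg 0 u -> u = 0.
Proof.
elim: ys u => [|y ys IH] u /=; first by case.
by case: u => [u1 u2] [/= /IH -> /IH ->].
Qed.

Lemma dg_0 ys i : koszul_deg i (0 : koszul ys).
Proof. by elim: ys i => [|y ys IH] i /=; [right | split; apply: IH]. Qed.

Lemma dgD ys i (u v : koszul ys) : koszul_deg i u -> koszul_deg i v -> koszul_deg i (u + v).
Proof.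
elim: ys i u v => [|y ys IH] i u v /=.
  by move=> [-> _|->]; [left | rewrite add0r].
by move=> [a1 a2] [b1 b2]; split; apply: IH.
Qed.

Lemma dgZ ys i a (u : koszul ys) : koszul_deg i u -> koszul_deg i (a *: u).
Proof.
elim: ys i u => [|y ys IH] i u /=.
  by move=> [->|->]; [left | rewrite scaler0; right].
by move=> [a1 a2]; split; apply: IH.
Qed.

Lemma dgN ys i (u : koszul ys) : koszul_deg i u -> koszul_deg i (- u).
Proof. by rewrite -scaleN1r; apply: dgZ. Qed.

Lemma dgB ys i (u v : koszul ys) : koszul_deg i u -> koszul_deg i v -> koszul_deg i (u - v).
Proof. by move=> hu hv; apply: dgD => //; apply: dgN. Qed.

Lemma dg_d ys i (u : koszul ys) : koszul_deg i u -> koszul_deg i.+1 (koszul_d u).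
Proof.
elim: ys i u => [|y ys IH] i u /=; first by right.
case: u => [u1 u2] /= [h1 h2]; split; first exact: IH.
apply: dgB; first exact: dgZ.
case: i h1 h2 => [|i] h1 h2; last exact: IH.
by rewrite (dg_zero h2) linear0; apply: dg_0.
Qed.

Lemma dg_h ys k i (u : koszul ys) : koszul_deg i.+1 u -> koszul_deg i (koszul_h k u).
Proof.
elim: ys k i u => [|y ys IH] k i u /=; first by right.
case: u => [u1 u2] /= [h1 h2]; case: k => [|k] /=; first by split=> //; apply: dg_0.
split; first exact: IH.
case: i h1 h2 => [|i] h1 h2; last by apply: dgN; apply: IH.
by rewrite (dg_zero h2) linear0 oppr0; apply: dg_0.
Qed.

(* Vanishing of the [i]-th Koszul cohomology of [S/P] with respect to [ys]. *)
Definition koszul_vanish P ys i := forall u : koszul ys, koszul_deg i.+1 u -> koszul_in P (koszul_d u) ->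
  exists2 w, koszul_deg i w & koszul_in P (u - koszul_d w).

(** Only the action on cohomology classes is recorded, one cocycle at a time; this makes such [a] an
    ideal, which contains [ys]. *)
Definition null_homotopic P ys a := forall i (u : koszul ys), koszul_deg i.+1 u -> koszul_in P (koszul_d u) ->
  exists2 w, koszul_deg i w & koszul_in P (a *: u - koszul_d w).

Section Null.
Variables (P : S -> Prop) (ys : seq S).
Hypothesis idP : ideal_like P.

Lemma nullh0 : null_homotopic P ys 0.
Proof.
move=> i u _ _; exists 0; first exact: dg_0.
by rewrite scale0r linear0 subr0; apply: kP0.
Qed.

Lemma nullhD a b : null_homotopic P ys a -> null_homotopic P ys b -> null_homotopic P ys (a + b).
Proof.
move=> ha hb i u du ku; have [w1 d1 k1] := ha i u du ku; have [w2 d2 k2] := hb i u du ku.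
exists (w1 + w2); first exact: dgD.
rewrite linearD /= scalerDl opprD addrACA; exact: kPD.
Qed.

Lemma nullhM a b : null_homotopic P ys b -> null_homotopic P ys (a * b).
Proof.
move=> hb i u du ku; have [w2 d2 k2] := hb i u du ku.
exists (a *: w2); first exact: dgZ.
by rewrite linearZ /= -scalerA -scalerBr; apply: kPZ.
Qed.

Lemma nullh_mem y : y \in ys -> null_homotopic P ys y.
Proof.
move=> hy i u du ku; exists (koszul_h (index y ys) u); first exact: dg_h.
have := kdh u (k := index y ys); rewrite index_mem nth_index // => /(_ hy) <-.
by rewrite addrAC subrr add0r; apply: kPh.
Qed.

End Null.

Lemma kP_split P P' th ys i (u : koszul ys) : ideal_like P ->
  (forall x, P' x -> exists2 q, P q & exists g, x = q + th * g) ->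
  koszul_deg i u -> koszul_in P' u -> exists p q : koszul ys, [/\ koszul_deg i q, koszul_in P p & u = p + th *: q].
Proof.
move=> idP hP'; elim: ys i u => [|y ys IH] i u /=.
  case=> [-> /hP' [q Pq [g ->]]|-> _].
    by exists q, g; split=> //; left.
  by exists 0, 0; split; [right | case: idP | rewrite scaler0 addr0].
case: u => [u1 u2] /= [d1 d2] [k1 k2].
have [p1 [q1 [e1 f1 ->]]] := IH _ _ d1 k1.
have [p2 [q2 [e2 f2 ->]]] := IH _ _ d2 k2.
by exists (p1, p2), (q1, q2).
Qed.

Lemma kP_reg P th ys (u : koszul ys) : (forall g, P (th * g) -> P g) ->
  koszul_in P (th *: u) -> koszul_in P u.
Proof.
move=> reg; elim: ys u => [|y ys IH] u /=; first exact: reg.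
by case: u => [u1 u2] [/= /IH h1 /IH h2].
Qed.

(* The long exact sequence of [0 -> S/P -> S/P -> S/P' -> 0] makes [th] injective on the
   cohomology, on which it acts by zero. *)
Lemma Hvan_reg P P' th ys i : ideal_like P -> ideal_like P' -> null_homotopic P ys th ->
  (forall g, P (th * g) -> P g) ->
  (forall x, P' x -> exists2 q, P q & exists g, x = q + th * g) ->
  (forall x, P x -> P' x) -> (forall x, P' (th * x)) ->
  (forall i', i = i'.+1 -> koszul_vanish P' ys i') -> koszul_vanish P ys i.
Proof.
move=> idP idP' nth reg hP' PP' thP' hv u du ku.
have kPP' ys' (v : koszul ys') : koszul_in P v -> koszul_in P' v.
  by elim: ys' v => [|y ys' IH] v /=; [exact: PP' | case=> /IH ? /IH].
have [w dw kw] := nth i u du ku.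
case: i hv du w dw kw => [|i] hv du w dw kw.
  exists 0; first exact: dg_0.
  rewrite linear0 subr0; apply: (kP_reg reg).
  by move: kw; rewrite (dg_zero dw) linear0 subr0.
(* Modulo [P'] the cochain [w] is a cocycle, and the connecting map sends its class to that of
   [u]. *)
have kw' : koszul_in P' (koszul_d w).
  have ->: koszul_d w = th *: u - (th *: u - koszul_d w) by rewrite opprB addrC subrK.
  apply: (kPB idP') (kPP' _ _ kw).
  by elim: (ys) (u) => [|y ys' IH] u' /=; [exact: thP' | split; apply: IH].
have [v dv kv] := hv i erefl w dw kw'.
have [p [q [dq kp e]]] := kP_split idP hP' (dgB dw (dg_d dv)) kv.
exists q => //; apply: (kP_reg reg).
have -> : th *: (u - koszul_d q) = (th *: u - koszul_d w) + koszul_d p.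
  have -> : koszul_d w = koszul_d p + th *: koszul_d q.
    have -> : w = koszul_d v + (p + th *: q) by rewrite -e addrC subrK.
    by rewrite (linearD (koszul_d (ys := ys))) /= kdd add0r linearD linearZ.
  by rewrite scalerBr opprD addrA addrAC subrK.
by apply: kPD => //; apply: kPd.
Qed.
End Koszul.

(** * Graded Nakayama for Koszul cohomology *)

Section Graded.
Variables (S : comNzRingType) (P : S -> Prop) (pr : nat -> S -> S).
Hypothesis idP : ideal_like P.
Hypothesis prB : forall e x y, pr e (x - y) = pr e x - pr e y.
Hypothesis pr_sum : forall x, exists N, forall M, (N <= M)%N -> x = \sum_(e < M) pr e x.
Hypothesis homP : forall e x, P x -> P (pr e x).

Definition deg1 y := (forall e x, pr e.+1 (y * x) = y * pr e x) /\ (forall x, pr 0 (y * x) = 0).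

Let pr0 e : pr e 0 = 0. Proof. by have := prB e 0 0; rewrite !subrr. Qed.

Lemma kmapB e ys (u v : koszul ys) : koszul_map (pr e) (u - v) = koszul_map (pr e) u - koszul_map (pr e) v.
Proof.
elim: ys u v => [|y ys IH] /=; first exact: prB.
by case=> [u1 u2] [v1 v2] /=; rewrite !IH.
Qed.

Lemma kmapZ t e ys (u : koszul ys) : deg1 t -> koszul_map (pr e.+1) (t *: u) = t *: koszul_map (pr e) u.
Proof.
case=> ht _; elim: ys u => [|y ys IH] u /=; first exact: ht.
by case: u => [u1 u2]; rewrite /= !IH.
Qed.

Lemma kmapZ0 t ys (u : koszul ys) : deg1 t -> koszul_map (pr 0) (t *: u) = 0.
Proof.
case=> _ ht; elim: ys u => [|y ys IH] u /=; first exact: ht.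
by case: u => [u1 u2]; rewrite /= !IH.
Qed.

Lemma kmap_d e ys (u : koszul ys) : (forall y, y \in ys -> deg1 y) ->
  koszul_map (pr e.+1) (koszul_d u) = koszul_d (koszul_map (pr e) u).
Proof.
elim: ys u => [|y ys IH] u hy /=; first exact: pr0.
have hys y' : y' \in ys -> deg1 y' by move=> h; apply: hy; rewrite inE h orbT.
rewrite kmapB kmapZ ?IH //; apply: hy; exact: mem_head.
Qed.

Lemma kmap_d0 ys (u : koszul ys) : (forall y, y \in ys -> deg1 y) -> koszul_map (pr 0) (koszul_d u) = 0.
Proof.
elim: ys u => [|y ys IH] u hy /=; first exact: pr0.
have hys y' : y' \in ys -> deg1 y' by move=> h; apply: hy; rewrite inE h orbT.
rewrite kmapB kmapZ0 ?IH ?subr0 //; apply: hy; exact: mem_head.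
Qed.

Lemma kmap_dg e i ys (u : koszul ys) : koszul_deg i u -> koszul_deg i (koszul_map (pr e) u).
Proof.
elim: ys i u => [|y ys IH] i u /=; first by case=> ->; [left | right; rewrite pr0].
by case=> h1 h2; split; apply: IH.
Qed.

Lemma kmap_P e ys (u : koszul ys) : koszul_in P u -> koszul_in P (koszul_map (pr e) u).
Proof.
elim: ys u => [|y ys IH] u /=; first exact: homP.
by case=> h1 h2; split; apply: IH.
Qed.

Lemma kmap_sum ys (u : koszul ys) :
  exists N, forall M, (N <= M)%N -> u = \sum_(e < M) koszul_map (pr e) u.
Proof.
elim: ys u => [|y ys IH] u /=; first exact: pr_sum.
case: u => [u1 u2] /=; have [N1 h1] := IH u1; have [N2 h2] := IH u2.
exists (maxn N1 N2) => M; rewrite geq_max => /andP[/h1 e1 /h2 e2].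
rewrite {1}e1 {1}e2; elim: (M) => [|M' IHM]; first by rewrite !big_ord0.
by rewrite !big_ord_recr /= -IHM.
Qed.

(* Graded Nakayama: cohomology is divisible by [t], hence zero since degrees are bounded below. *)
Lemma Hvan_behead t (ys : seq S) i : deg1 t -> (forall y, y \in ys -> deg1 y) ->
  koszul_vanish P (t :: ys) i.+1 -> koszul_vanish P ys i.
Proof.
move=> ht hys hv u du ku.
have d0v v : koszul_deg i.+1 v -> koszul_deg i.+2 ((0, v) : koszul (t :: ys)) by split=> //; apply: dg_0.
have k0v v : koszul_in P (koszul_d v) -> koszul_in P (koszul_d ((0, v) : koszul (t :: ys))).
  by split; [rewrite /= linear0; apply: kP0 | rewrite /= scaler0 sub0r; apply: kPN].
(* That [(0, v)] is a coboundary modulo [P] says that [v = t * p - d q] with [p] again a cocycle; so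
   the part of [v] of degree [e.+1] is governed by the part of [p] of degree [e]. *)
have bd e v : koszul_deg i.+1 v -> koszul_in P (koszul_d v) ->
    exists2 w, koszul_deg i w & koszul_in P (koszul_map (pr e) v - @koszul_d S ys w).
  elim: e v => [|e IH] v dv kv.
    have [[p q] /= [dp dq] [kp kq]] := hv (0, v) (d0v v dv) (k0v v kv).
    exists 0; first exact: dg_0.
    have := kmap_P 0 kq; rewrite !kmapB kmapZ0 // kmap_d0 //.
    by rewrite (linear0 (koszul_d (ys := ys))) !subr0.
  have [[p q] /= [dp dq] [kp kq]] := hv (0, v) (d0v v dv) (k0v v kv).
  have kp' : koszul_in P (koszul_d p) by move: kp => /(kPN idP); rewrite sub0r opprK.
  have [w dw kw] := IH p dp kp'.
  exists (t *: w - koszul_map (pr e) q).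
    by apply: dgB; [apply: dgZ | apply: kmap_dg].
  have := kmap_P e.+1 kq; rewrite !kmapB kmapZ // kmap_d // => /(kPD idP).
  move/(_ _ (kPZ idP t kw)); rewrite kdB kdZ scalerBr.
  set a := koszul_map _ v; set b := t *: _; set c := koszul_d _; set d := t *: _.
  by rewrite (_ : a - (b - c) + (b - d) = a - (d - c)) // !opprB !addrA subrK.
have [N hN] := kmap_sum u.
rewrite (hN N (leqnn N)); elim: N {hN} => [|N [w dw kw]].
  exists 0; first exact: dg_0.
  by rewrite big_ord0 linear0 subr0; apply: kP0.
have [w' dw' kw'] := bd N u du ku.
exists (w + w'); first exact: dgD.
by rewrite big_ord_recr /= linearD /= opprD addrACA; apply: kPD.
Qed.

Lemma Hvan_drop ts ys i : (forall y, y \in ts ++ ys -> deg1 y) ->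
  koszul_vanish P (ts ++ ys) (size ts + i) -> koszul_vanish P ys i.
Proof.
elim: ts => [|t ts IH] //= hy hv; have hy' y : y \in ts ++ ys -> deg1 y.
  by move=> h; apply: hy; rewrite inE h orbT.
by apply: IH => //; apply: Hvan_behead hv => //; apply: hy; apply: mem_head.
Qed.

End Graded.

(** * First Koszul cohomology made explicit *)

Section DegreeOne.
Variable S : comNzRingType.

Fixpoint cochain0 (ys : seq S) (c : S) : koszul ys :=
  match ys with [::] => c | y :: ys' => (cochain0 ys' c, 0) end.

Fixpoint cochain1 (ys : seq S) (g : S -> S) : koszul ys :=
  match ys with [::] => 0 | y :: ys' => (cochain1 ys' g, cochain0 ys' (g y)) end.

Lemma dg_kc ys c : koszul_deg 1 (cochain0 ys c).
Proof. by elim: ys => [|y ys IH] /=; [left | split=> //; apply: dg_0]. Qed.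

Lemma dg_k1 ys g : koszul_deg 2 (cochain1 ys g).
Proof. by elim: ys => [|y ys IH] /=; [right | split=> //; apply: dg_kc]. Qed.

Lemma dg1P ys (w : koszul ys) : koszul_deg 1 w -> exists h, w = cochain0 ys h.
Proof.
elim: ys w => [|y ys IH] w /=; first by exists w.
by case: w => w1 w2 /= [/IH [h ->] /dg_zero ->]; exists h.
Qed.

Lemma kcZ ys a c : a *: cochain0 ys c = cochain0 ys (a * c).
Proof. by elim: ys => [|y ys IH] //=; rewrite -IH; congr pair; rewrite /= scaler0. Qed.

Lemma kcB ys c c' : cochain0 ys c - cochain0 ys c' = cochain0 ys (c - c').
Proof. by elim: ys => [|y ys IH] //=; rewrite -IH; congr pair; rewrite /= subr0. Qed.

Lemma kd_kc ys c : koszul_d (cochain0 ys c) = cochain1 ys (fun y => y * c).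
Proof.
by elim: ys => [|y ys IH] //=; rewrite IH linear0 subr0 kcZ.
Qed.

Lemma k1Z ys a g : a *: cochain1 ys g = cochain1 ys (fun y => a * g y).
Proof. by elim: ys => [|y ys IH] /=; [rewrite scaler0 | rewrite -IH -kcZ]. Qed.

Lemma k1B ys g g' : cochain1 ys g - cochain1 ys g' = cochain1 ys (fun y => g y - g' y).
Proof. by elim: ys => [|y ys IH] /=; [rewrite subr0 | rewrite -IH -kcB]. Qed.

Lemma kP_kc P ys c : P 0 -> P c <-> koszul_in P (cochain0 ys c).
Proof.
move=> P0; elim: ys => [|y ys IH] //=; rewrite IH; split=> [h|[]//]; split=> //.
by elim: (ys).
Qed.

Lemma kP_k1 P ys g : P 0 -> (forall y, y \in ys -> P (g y)) <-> koszul_in P (cochain1 ys g).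
Proof.
move=> P0; elim: ys => [|y ys IH] //=; split.
  move=> h; split; last by apply/kP_kc => //; apply: h; apply: mem_head.
  by apply/IH => y' hy; apply: h; rewrite inE hy orbT.
case=> /IH h h' y'; rewrite inE => /orP[/eqP ->|/h //].
by apply/(kP_kc ys _ P0).
Qed.

(** The compatibility of the [g y] is the cocycle condition for the 1-cochain with coefficient [g y]
    at [y], and a coboundary is a family of multiples [y * h] of one [h]. *)
Lemma Hvan1 P ys (g : S -> S) : ideal_like P ->
  (forall y y', y \in ys -> y' \in ys -> P (y * g y' - y' * g y)) ->
  koszul_vanish P ys 1 -> exists h, forall y, y \in ys -> P (g y - y * h).
Proof.
move=> idP hg hv; have [P0 _ _] := idP.
have [||w /dg1P [h ->]] := hv (cochain1 ys g); first exact: dg_k1.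
  elim: (ys) hg => [|y ys' IH] hg //=; split.
    by apply: IH => a b ha hb; apply: hg; rewrite inE ?ha ?hb orbT.
  rewrite kd_kc k1Z k1B; apply/kP_k1 => // y' hy'.
  by apply: hg; rewrite inE ?eqxx ?hy' ?orbT.
by rewrite kd_kc k1B => hh; exists h; apply/(kP_k1 ys _ P0).
Qed.

End DegreeOne.

(** * Regular sequences and vanishing of Koszul cohomology *)

Section SumIdeal.
Variables (C : comNzRingType) (n : nat) (I : {mpoly C[n]} -> Prop).
Local Notation S := {mpoly C[n]}.
Hypothesis idI : is_ideal I.
Implicit Types (fs : seq S) (p f : S).

Lemma in_sum_idealP fs p : in_sum_ideal I fs p <->
  exists q (G : nat -> S), I q /\ p = q + \sum_(i < size fs) G i * fs`_i.
Proof.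
split=> [[q [gs [Iq [_ ->]]]]|[q [G [Iq ->]]]]; first by exists q, (nth 0 gs).
exists q, (mkseq G (size fs)); rewrite size_mkseq; split=> //; split=> //.
by congr (_ + _); apply: eq_bigr => i _; rewrite nth_mkseq.
Qed.

Lemma in_sum_ideal_like fs : ideal_like (in_sum_ideal I fs).
Proof.
case: idI => I0 ID IM; split.
- apply/in_sum_idealP; exists 0, (fun=> 0); split=> //.
  by rewrite add0r big1 // => i _; rewrite mul0r.
- move=> x y /in_sum_idealP[q [G [Iq ->]]] /in_sum_idealP[q' [G' [Iq' ->]]].
  apply/in_sum_idealP; exists (q + q'), (fun i => G i + G' i); split; first exact: ID.
  rewrite addrACA -big_split /=; congr (_ + _).
  by apply: eq_bigr => i _; rewrite mulrDl.
- move=> a x /in_sum_idealP[q [G [Iq ->]]].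
  apply/in_sum_idealP; exists (a * q), (fun i => a * G i); split; first exact: IM.
  rewrite mulrDr mulr_sumr; congr (_ + _).
  by apply: eq_bigr => i _; rewrite mulrA.
Qed.

Lemma in_sum_ideal_nil p : in_sum_ideal I [::] p <-> I p.
Proof.
rewrite in_sum_idealP; split=> [[q [G [Iq ->]]]|Ip].
  by rewrite big_ord0 addr0.
by exists p, (fun=> 0); rewrite big_ord0 addr0.
Qed.

Lemma in_sum_ideal_rcons fs f p : in_sum_ideal I (rcons fs f) p <->
  exists2 q, in_sum_ideal I fs q & exists g, p = q + f * g.
Proof.
split.
  move=> /in_sum_idealP[q [G [Iq ->]]].
  exists (q + \sum_(i < size fs) G i * fs`_i).
    by apply/in_sum_idealP; exists q, G.
  exists (G (size fs)); rewrite size_rcons big_ord_recr /= nth_rcons ltnn eqxx mulrC addrA.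
  by congr (_ + _ + _); apply: eq_bigr => i _; rewrite nth_rcons ltn_ord.
case=> q /in_sum_idealP[q' [G [Iq ->]]] [g ->]; apply/in_sum_idealP.
exists q', (fun i => if i == size fs then g else G i); split=> //.
rewrite size_rcons big_ord_recr /= nth_rcons ltnn !eqxx mulrC addrA.
congr (_ + _ + _); apply: eq_bigr => i _.
by rewrite nth_rcons ltn_ord (ltn_eqF (ltn_ord i)).
Qed.

Definition in_span (ys : seq S) f :=
  forall J : S -> Prop, ideal_like J -> (forall y, y \in ys -> J y) -> J f.

Lemma in_span_null P ys f : ideal_like P -> in_span ys f -> null_homotopic P ys f.
Proof.
move=> idP; apply; last by move=> y; apply: nullh_mem.
split; [exact: nullh0 | by move=> x y; apply: nullhD | by move=> a x; apply: nullhM].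
Qed.

(** Induction on the number [k] of elements left after dividing by the first [j]: by [Hvan_reg] each
    of them yields vanishing in one more degree. *)
Lemma regular_seq_Hvan ys fs : (forall f, f \in fs -> in_span ys f) ->
  regular_seq I fs -> forall i, (i < size fs)%N -> koszul_vanish I ys i.
Proof.
move=> hys [_ reg].
have H k : forall j, (j + k = size fs)%N -> forall i, (i < k)%N ->
    koszul_vanish (in_sum_ideal I (take j fs)) ys i.
  elim: k => [//|k IH] j hj i hi.
  have jlt : (j < size fs)%N by rewrite -hj addnS ltnS leq_addr.
  have sumj := in_sum_ideal_like (take j fs).
  have etake : take j.+1 fs = rcons (take j fs) fs`_j by rewrite (take_nth 0).
  apply: (@Hvan_reg _ _ (in_sum_ideal I (take j.+1 fs)) fs`_j) => //.
  - exact: in_sum_ideal_like.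
  - by apply: in_span_null => //; apply: hys; apply: mem_nth.
  - exact: reg.
  - by move=> x; rewrite etake => /in_sum_ideal_rcons.
  - move=> x hx; rewrite etake; apply/in_sum_ideal_rcons.
    by exists x => //; exists 0; rewrite mulr0 addr0.
  - move=> x; rewrite etake; apply/in_sum_ideal_rcons.
    by exists 0; [case: sumj | exists x; rewrite add0r].
  - by move=> i' ei; apply: IH; [rewrite addSnnS | rewrite -ltnS -ei].
move=> i hi u du ku.
have nilE ys' (v : koszul ys') : koszul_in (in_sum_ideal I (take 0 fs)) v <-> koszul_in I v.
  rewrite take0; elim: ys' v => [|y ys' IH] v /=; first exact: in_sum_ideal_nil.
  by rewrite !IH.
have [|w dw kw] := H (size fs) 0%N (add0n _) i hi u du; first exact/nilE.
by exists w => //; apply/nilE.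
Qed.

End SumIdeal.

(** * The standard grading on polynomials *)

Section MpolyGraded.
Variables (C : comNzRingType) (n : nat).
Local Notation S := {mpoly C[n]}.

Lemma pihomogM1 (y x : S) k e : y \is k.-homog ->
  pihomog mdeg e (y * x) = if (k <= e)%N then y * pihomog mdeg (e - k) x else 0.
Proof.
move=> hy; have hx := pihomog_partitionE (leqnn (mmeasure mdeg x)).
rewrite [in LHS]hx mulr_sumr linear_sum /=.
have term i : pihomog mdeg e (y * pihomog mdeg i x) =
    if (k + i == e)%N then y * pihomog mdeg i x else 0.
  have hyi : y * pihomog mdeg i x \is (k + i).-homog by apply: dhomogM => //; apply: pihomogP.
  by case: eqP => [<-|/eqP ne]; [rewrite pihomog_dE | rewrite (pihomog_ne0 _ hyi) // ].
under eq_bigr => i _ do rewrite term.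
rewrite -big_mkcond /=.
case: leqP => hke; last by rewrite big1 // => i /eqP ei; move: hke; rewrite -ei ltnNge leq_addr.
have [lt|ge] := ltnP (e - k) (mmeasure mdeg x).
  rewrite (big_pred1 (Ordinal lt)) // => i /=.
  apply/eqP/eqP => [ei|->]; last by rewrite /= subnKC.
  by apply: val_inj; rewrite /= -ei addKn.
rewrite big_pred0 => [|i]; last first.
  apply/negbTE; rewrite -(subnKC hke) eqn_add2l; apply/negP => /eqP ei.
  by have := ltn_ord i; rewrite ei ltnNge ge.
rewrite hx linear_sum /= big1 ?mulr0 // => i _.
rewrite (pihomog_ne0 _ (pihomogP mdeg i x)) //.
by apply/negP => /eqP ei; have := ltn_ord i; rewrite ei ltnNge ge.
Qed.

Lemma dhomog_deg1 (y : S) : y \is 1.-homog -> deg1 (fun e => pihomog mdeg e) y.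
Proof.
by move=> hy; split=> [e x|x]; rewrite (pihomogM1 _ _ hy) //= subn1.
Qed.

Lemma irrelevant_in_span (ys : seq S) f :
  (forall i, in_span ys 'X_i) -> in_irrelevant f -> in_span ys f.
Proof.
move=> hX f0 J [J0 JD JM] hJ; rewrite (mpolyE f) big_seq.
apply: big_ind => // m hm; rewrite -mul_mpolyC; apply: (JM).
have [i hi] : exists i, (0 < m i)%N.
  case: (pickP (fun i => 0 < m i)%N) => [i hi|m0]; first by exists i.
  move: hm; have -> : m = 0%MM.
    by apply/mnmP => i; rewrite mnm0E; apply/eqP; rewrite -leqn0 leqNgt m0.
  by rewrite mcoeff_msupp f0 eqxx.
rewrite (_ : m = (m - U_(i) + U_(i))%MM); last first.
  by rewrite submK //; apply/mnm_lepP => j; rewrite mnm1E; case: eqP => // <-.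
by rewrite mpolyXD; apply: (JM); apply: (hX i J).
Qed.

(* A section off the zero set of [ls] extends once the depth is at least [size ts + 2]: this is
   [H^1(ls; S/I) = 0]. *)
Lemma depth_extension (I : S -> Prop) (fs ts ls : seq S) (g : S -> S) :
  is_ideal I -> (forall e p, I p -> I (pihomog mdeg e p)) ->
  (forall f, f \in fs -> in_irrelevant f) -> regular_seq I fs ->
  (size ts + 2 <= size fs)%N ->
  (forall y, y \in ts ++ ls -> y \is 1.-homog) ->
  (forall i : 'I_n, exists t l, [/\ t \in ts, l \in ls & 'X_i = t + l]) ->
  (forall y y', y \in ls -> y' \in ls -> I (y * g y' - y' * g y)) ->
  exists h, forall y, y \in ls -> I (g y - y * h).
Proof.
move=> idI homI irr reg sz hom1 hX hg.
have spanX i : in_span (ts ++ ls) 'X_i.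
  move=> J [J0 JD JM] hJ; have [t [l [ht hl ->]]] := hX i.
  by apply: JD; apply: hJ; rewrite mem_cat ?ht ?hl ?orbT.
(* Together [ts] and [ls] generate the ideal of the origin, so depth controls their cohomology;
   removing each element of [ts] then costs one degree, down to degree 1. *)
have hv : koszul_vanish I (ts ++ ls) (size ts + 1).
  apply: (regular_seq_Hvan idI _ reg); last by rewrite -addnS in sz *.
  by move=> f hf; apply: irrelevant_in_span => //; apply: irr.
apply: Hvan1 => //.
apply: (@Hvan_drop _ _ (fun e => pihomog mdeg e)) hv => //.
- by move=> e x y; rewrite pihomogB.
- move=> x; exists (mmeasure mdeg x) => M hM; exact: pihomog_partitionE.
- by move=> y hy; apply: dhomog_deg1; apply: hom1.
Qed.

End MpolyGraded.

(** * Vanishing ideals and dimension *)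

Section PolyFun.
Variable C : numFieldType.

(** The roots used are 1, 2, 3 and so on. The value 0 is left out because in [no_extension] it
    corresponds to a point of [W], where the section is not tested. *)
Lemma poly_eq0_fun (p : {poly C}) : (forall t, t != 0 -> p.[t] = 0) -> p = 0.
Proof.
move=> hp; apply: (@roots_geq_poly_eq0 _ p [seq i.+1%:R | i <- iota 0 (size p)]).
- by apply/allP => x /mapP[i _ ->]; apply/rootP; apply: hp; rewrite pnatr_eq0.
- rewrite map_inj_uniq ?iota_uniq // => i j /eqP.
  by rewrite eqr_nat => /eqP[].
- by rewrite size_map size_iota.
Qed.

Variable n : nat.
Local Notation S := {mpoly C[n]}.

Lemma horner_mmap (u : 'I_n -> {poly C}) (p : S) t :
  (mmap polyC u p).[t] = p.@[fun i => (u i).[t]].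
Proof.
rewrite /mmap horner_sum mevalE; apply: eq_bigr => m _.
rewrite hornerM hornerC; congr (_ * _); rewrite /mmap1 horner_prod.
by apply: eq_bigr => i _; rewrite horner_exp.
Qed.

Lemma meval_homog (p : S) d x t : p \is d.-homog -> p.@[fun i => t * x i] = t ^+ d * p.@[x].
Proof.
move=> /dhomogP hp; rewrite !mevalE mulr_sumr !big_seq; apply: eq_bigr => m hm.
rewrite mulrCA; congr (_ * _); have -> : d = (\sum_i m i)%N by rewrite -mdegE; apply/esym/hp.
by rewrite -prodrXr -big_split; apply: eq_bigr => i _; rewrite /= exprMn.
Qed.

Lemma vanishing_is_ideal (X : ('I_n -> C) -> Prop) : is_ideal (vanishing_ideal X).
Proof.
split=> [x _|x y hx hy z hz|a x hx z hz]; first by rewrite meval0.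
  by rewrite mevalD hx // hy // addr0.
by rewrite mevalM hx // mulr0.
Qed.

(** On the line through [x] and the origin, [p] is a polynomial in the scaling factor whose
    coefficients are the values at [x] of its homogeneous parts. *)
Lemma vanishing_homog (X : ('I_n -> C) -> Prop) :
  (forall t x, X x -> X (fun i => t * x i)) ->
  forall e p, vanishing_ideal X p -> vanishing_ideal X (pihomog mdeg e p).
Proof.
move=> hX e p hp x Xx; have hs := pihomog_partitionE (leqnn (mmeasure mdeg p)).
have [lt|ge] := ltnP e (mmeasure mdeg p); last first.
  suff -> : pihomog mdeg e p = 0 by rewrite meval0.
  rewrite hs linear_sum /= big1 // => i _.
  rewrite (pihomog_ne0 _ (pihomogP mdeg i p)) //.
  by apply/negP => /eqP ei; have := ltn_ord i; rewrite ei ltnNge ge.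
have h0 : \poly_(i < mmeasure mdeg p) (pihomog mdeg i p).@[x] = 0.
  apply: poly_eq0_fun => t _; rewrite horner_poly.
  rewrite -[RHS](hp _ (hX t x Xx)) [in RHS]hs raddf_sum /=.
  by apply: eq_bigr => i _; rewrite (meval_homog _ _ (pihomogP mdeg i p)) mulrC.
by have := congr1 (fun q : {poly C} => q`_e) h0; rewrite coef_poly lt coef0.
Qed.

(** Restrict to the line joining a point where [p] is nonzero to one where [q] is nonzero: there the
    product would vanish in the domain of polynomials in [t]. *)
Lemma vanishing_prime (V : ('I_n -> C) -> Prop) :
  (exists x, V x) ->
  (forall a b t, V a -> V b -> V (fun i => a i + t * (b i - a i))) ->
  is_prime (vanishing_ideal V).
Proof.
move=> [x0 Vx0] hV; split; first exact: vanishing_is_ideal.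
  by move=> /(_ x0 Vx0) /eqP; rewrite meval1 oner_eq0.
move=> p q hpq; apply: NNPP => /not_or_and[np nq].
have [a na] := not_all_ex_not _ _ np; have [Va pa] := imply_to_and _ _ na.
have [b nb] := not_all_ex_not _ _ nq; have [Vb qb] := imply_to_and _ _ nb.
pose u i := (a i)%:P + 'X * (b i - a i)%:P.
have uE r t : (mmap polyC u r).[t] = r.@[fun i => a i + t * (b i - a i)].
  rewrite horner_mmap; apply: meval_eq => i.
  by rewrite /u hornerD hornerC hornerM hornerX hornerC.
have : mmap polyC u p * mmap polyC u q = 0.
  by apply: poly_eq0_fun => t _; rewrite hornerM !uE -mevalM; apply: hpq; apply: hV.
move/eqP; rewrite mulf_eq0 => /orP[]/eqP h0.
  apply: pa; have := uE p 0; rewrite h0 horner0 => /esym <-.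
  by apply: meval_eq => i; rewrite mul0r addr0.
apply: qb; have := uE q 1; rewrite h0 horner0 => /esym <-.
by apply: meval_eq => i; rewrite mul1r addrC subrK.
Qed.

End PolyFun.

Lemma sum_blk l k : (\sum_(0 <= i < sumn l) (blk l i == k))%N = nth 0%N l k.
Proof.
elim: l k => [|a l IH] k /=; first by rewrite big_geq // nth_nil.
rewrite (@big_cat_nat _ _ _ a) ?leq_addr //=.
rewrite (eq_big_nat _ _ (F2 := fun=> (0 == k : nat))); last by move=> i /andP[_ ->].
rewrite sum_nat_const_nat subn0 (addnC a) -{2}(add0n a) big_addn addnK.
rewrite (eq_big_nat _ _ (F2 := fun i => (blk l i).+1 == k : nat)); last first.
  by move=> i _; rewrite ltnNge leq_addl addnK.
case: k => [|k] /=; last by rewrite muln0 add0n -IH.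
by rewrite muln1 big1 ?addn0.
Qed.

Lemma card_blk n l k : n = sumn l -> #|[set i : 'I_n | blk l i == k]| = nth 0%N l k.
Proof.
move=> ->; rewrite -sum_blk -sum1dep_card big_mkcond big_mkord /=.
by apply: eq_bigr => i _; case: eqP.
Qed.

Lemma blk_lt l i : (i < sumn l)%N -> (blk l i < size l)%N.
Proof.
elim: l i => [|a l IH] i //=; case: (ltnP i a) => // hai hi.
by rewrite ltnS; apply: IH; rewrite ltn_subLR.
Qed.

Lemma X_lambda_scale (C : comNzRingType) n l t (x : 'I_n -> C) :
  X_lambda l x -> X_lambda l (fun i => t * x i).
Proof.
move=> [s [y [Ey hx]]]; exists s, (fun i => t * y i); split=> [i j /Ey -> //|i].
by rewrite hx.
Qed.

(** The chain comes from the subspaces of [E_lambda] on which the first [k] block values are zero.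
    The lower bound on the dimension is what makes the regular sequence long enough. *)
Lemma chain_above_X_lambda (C : numFieldType) n l : n = sumn l -> all (leq 1) l ->
  chain_above (vanishing_ideal (X_lambda (C := C) (n := n) l)) (size l).
Proof.
move=> hn hl.
pose V k (x : 'I_n -> C) := exists v : nat -> C,
  (forall j, (j < k)%N -> v j = 0) /\ forall i : 'I_n, x i = v (blk l i).
exists (fun k => vanishing_ideal (V k)); split=> k hk.
  split.
    apply: vanishing_prime; first by exists (fun=> 0), (fun=> 0).
    move=> a b t [v [v0 va]] [w [w0 wb]].
    exists (fun j => v j + t * (w j - v j)); split=> [j hj|i]; last by rewrite va wb.
    by rewrite v0 // w0 // subrr mulr0 addr0.
  move=> p hp x [v [_ xv]]; apply: hp; exists 1%g, x; split=> [i j e|i].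
    by rewrite !xv e.
  by rewrite perm1.
split.
  move=> p hp x [v [v0 xv]]; apply: hp; exists v; split=> // j hj.
  by apply: v0; apply: ltnW.
have [i hi] : exists i, i \in [set i : 'I_n | blk l i == k].
  by apply/card_gt0P; rewrite card_blk //; move/allP: hl; apply; apply: mem_nth.
move: hi; rewrite inE => /eqP bi; exists 'X_i; split.
  by move=> x [v [v0 xv]]; rewrite mevalXU xv bi v0.
pose v (j : nat) : C := (j == k)%:R.
move=> /(_ (fun i => v (blk l i))); rewrite mevalXU /v bi eqxx => h; suff: (1 : C) == 0 by rewrite oner_eq0.
apply/eqP; apply: h.
exists v; split=> // j hj; rewrite /v ltn_eqF //.
Qed.

(** * The section off the codimension 2 stratum *)

Section Local.
Variables (C : numFieldType) (n : nat).
Local Notation S := {mpoly C[n]}.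
Implicit Types (x : 'I_n -> C) (A B E U V D : {set 'I_n}).

Definition const_on x A z := forall i, i \in A -> x i = z.

Definition three_blocks b c D A B E :=
  [/\ D = A :|: B :|: E, [/\ [disjoint A & B], [disjoint A & E] & [disjoint B & E]] &
     [/\ #|A| = (b + c)%N, #|B| = b & #|E| = c]].

Definition phi (z u v : C) := (z - u) ^+ 2 * (z - v) ^+ 2 * (u - v).

Definition section_val b c o A B (z u v : C) : C :=
  if o \in A then 0 else if o \in B then c%:R * phi z u v else - b%:R * phi z u v.

Definition sumX U : S := \sum_(i in U) 'X_i.
(** Deviation from the mean over [U], cleared of its denominator. *)
Definition cenX U i : S := #|U|%:R%:MP * 'X_i - sumX U.
Definition cenS U k : S := \sum_(i in U) cenX U i ^+ k.

Lemma meval_sumX U x : (sumX U).@[x] = \sum_(i in U) x i.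
Proof. by rewrite /sumX raddf_sum; apply: eq_bigr => i _; rewrite /= mevalXU. Qed.

Lemma meval_cenX U i x : (cenX U i).@[x] = #|U|%:R * x i - \sum_(i in U) x i.
Proof. by rewrite mevalB mevalM mevalC mevalXU meval_sumX. Qed.

Lemma meval_cenS U k x :
  (cenS U k).@[x] = \sum_(i in U) (#|U|%:R * x i - \sum_(i in U) x i) ^+ k.
Proof.
rewrite /cenS raddf_sum; apply: eq_bigr => i _ /=.
by rewrite rmorphXn /= meval_cenX.
Qed.

Lemma sum_on A z (f : 'I_n -> C) : (forall i, i \in A -> f i = z) ->
  \sum_(i in A) f i = #|A|%:R * z.
Proof. by move=> h; rewrite (eq_bigr _ h) sumr_const mulr_natl. Qed.

Lemma sum_on2 A B z u (f : 'I_n -> C) : [disjoint A & B] ->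
  (forall i, i \in A -> f i = z) -> (forall i, i \in B -> f i = u) ->
  \sum_(i in A :|: B) f i = #|A|%:R * z + #|B|%:R * u.
Proof.
move=> dAB hA hB; rewrite (eq_bigl [predU A & B]) => [|i]; last by rewrite !inE.
by rewrite bigU //= (sum_on hA) (sum_on hB).
Qed.

Section TwoBlocks.
Variables (A B : {set 'I_n}) (x : 'I_n -> C) (s t : C).
Hypotheses (dAB : [disjoint A & B]) (hA : const_on x A s) (hB : const_on x B t).
Let p : C := #|A|%:R.
Let q : C := #|B|%:R.

Lemma card2 : #|A :|: B|%:R = p + q.
Proof. by rewrite cardsU (disjoint_setI0 dAB) cards0 subn0 natrD. Qed.

Lemma sumX2 : (sumX (A :|: B)).@[x] = p * s + q * t.
Proof. by rewrite meval_sumX (sum_on2 dAB hA hB). Qed.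

Lemma cenX2A i : i \in A -> (cenX (A :|: B) i).@[x] = q * (s - t).
Proof. by move=> iA; rewrite meval_cenX card2 (sum_on2 dAB hA hB) hA // -/p -/q; ring. Qed.

Lemma cenX2B i : i \in B -> (cenX (A :|: B) i).@[x] = - p * (s - t).
Proof. by move=> iB; rewrite meval_cenX card2 (sum_on2 dAB hA hB) hB // -/p -/q; ring. Qed.

Lemma cenS2 k : (cenS (A :|: B) k).@[x] = p * (q * (s - t)) ^+ k + q * (- p * (s - t)) ^+ k.
Proof.
rewrite meval_cenS; apply: sum_on2 => // i hi.
  by rewrite -(cenX2A hi) meval_cenX.
by rewrite -(cenX2B hi) meval_cenX.
Qed.

End TwoBlocks.

Lemma cenX1 U x z i : const_on x U z -> i \in U -> (cenX U i).@[x] = 0.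
Proof. by move=> h iU; rewrite meval_cenX (sum_on h) h // subrr. Qed.

Lemma cenS1 U x z k : const_on x U z -> (cenS U k.+1).@[x] = 0.
Proof.
move=> h; rewrite meval_cenS big1 // => i iU.
by rewrite (sum_on h) h // subrr expr0n.
Qed.

Lemma natr_neq b c : b != c -> (b%:R - c%:R : C) != 0.
Proof. by move=> h; rewrite subr_eq0 eqr_nat. Qed.

Ltac mevalE := rewrite ?(mevalD, mevalB, mevalN, mevalM, mevalC, rmorphXn, mevalXU) /=.

(* Since the sizes of the two blocks merging into [U] differ, the square and the cube of the
   difference of their values are polynomials in the centred power sums; the first power is not. *)
Lemma local_big_small b c o U V : (0 < b)%N -> (0 < c)%N -> (0 < #|V|)%N ->
  o \in U :|: V -> [disjoint U & V] ->
  exists g : S, forall x A B z u v, [disjoint A & B] -> U = A :|: B ->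
    #|A| = (b + c)%N -> #|B| = b -> const_on x A z -> const_on x B u -> const_on x V v ->
    g.@[x] = section_val b c o A B z u v.
Proof.
move=> b0 c0 V0 oUV dUV.
have [p pE] : exists p : C, p = (b + c)%:R by exists (b + c)%:R.
have [q qE] : exists q : C, q = b%:R by exists b%:R.
have p0 : p != 0 by rewrite ?pE ?qE pnatr_eq0; lia.
have q0 : q != 0 by rewrite ?pE ?qE pnatr_eq0; lia.
have pq0 : p + q != 0 by rewrite pE qE -natrD pnatr_eq0; lia.
have pmq0 : p - q != 0 by rewrite pE qE; apply: natr_neq; lia.
pose D2 : S := (p * q * (p + q))^-1%:MP * cenS U 2.
pose D3 : S := (p * q * (q ^+ 2 - p ^+ 2))^-1%:MP * cenS U 3.
have qp0 : q ^+ 2 - p ^+ 2 != 0.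
  by rewrite subr_sqr mulf_neq0 // ?[q + p]addrC // -opprB oppr_eq0.
have D2E x A B z u : [disjoint A & B] -> U = A :|: B ->
    #|A| = (b + c)%N -> #|B| = b -> const_on x A z -> const_on x B u -> D2.@[x] = (z - u) ^+ 2.
  move=> dAB eU cA cB hA hB; rewrite /D2 mevalM mevalC eU (cenS2 dAB hA hB) cA cB -?pE -?qE.
  by field; rewrite p0 q0 pq0.
have D3E x A B z u : [disjoint A & B] -> U = A :|: B ->
    #|A| = (b + c)%N -> #|B| = b -> const_on x A z -> const_on x B u -> D3.@[x] = (z - u) ^+ 3.
  move=> dAB eU cA cB hA hB; rewrite /D3 mevalM mevalC eU (cenS2 dAB hA hB) cA cB -?pE -?qE.
  by field; rewrite p0 q0 qp0.
clearbody D2 D3.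
have [oV|oV] := boolP (o \in V).
  (* With [d = z - u] one has [z - v = (S' + q d) / (p + q)] and [u - v = (S' - p d) / (p + q)]. The
     witness expands [- q * phi] accordingly, the powers [d ^ 2] to [d ^ 5] being products of [D2]
     and [D3]. *)
  pose S' : S := sumX U - (p + q)%:MP * 'X_o.
  exists ((- q / (p + q) ^+ 3)%:MP * (S' ^+ 3 * D2 + (2 * q - p)%:MP * (S' ^+ 2 * D3)
     + (q ^+ 2 - 2 * p * q)%:MP * (S' * D2 ^+ 2) - (p * q ^+ 2)%:MP * (D2 * D3))).
  move=> x A B z u v dAB eU cA cB hA hB hV.
  have oU : o \notin U by apply: contraL oV => oU; rewrite (disjointFr dUV).
  rewrite /section_val; move: oU; rewrite eU inE negb_or => /andP[/negbTE -> /negbTE ->].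
  mevalE; rewrite (D2E _ _ _ _ _ dAB eU cA cB hA hB) (D3E _ _ _ _ _ dAB eU cA cB hA hB).
  have -> : (sumX U).@[x] = p * z + q * u by rewrite eU (sumX2 dAB hA hB) cA cB -pE -qE.
  by rewrite (hV o oV) -?pE -?qE /phi; field.
have oU : o \in U by move: oUV; rewrite inE (negbTE oV) orbF.
have /card_gt0P [k kV] := V0.
have [w wE] : exists w : S, w = cenX U o by exists (cenX U o).
(* As [w] is [q d] on [A] and [- p d] on [B], the first factor is zero on [A] and [c * d ^ 2] on
   [B]; in the latter case [x_o = u], so [z] is recovered from [sumX U]. *)
exists ((c%:R / (p ^+ 2 - q ^+ 2))%:MP * (w ^+ 2 - (q ^+ 2)%:MP * D2)
   * (p^-1%:MP * (sumX U - q%:MP * 'X_o) - 'X_k) ^+ 2 * ('X_o - 'X_k)).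
move=> x A B z u v dAB eU cA cB hA hB hV.
mevalE; rewrite (D2E _ _ _ _ _ dAB eU cA cB hA hB) (hV k kV).
have -> : (sumX U).@[x] = p * z + q * u by rewrite eU (sumX2 dAB hA hB) cA cB -pE -qE.
have pq0' : p ^+ 2 - q ^+ 2 != 0 by rewrite -opprB oppr_eq0.
rewrite /section_val; case: ifP => oA.
  by rewrite wE eU (cenX2A dAB hA hB) // cB -?qE; ring.
have oB : o \in B by move: oU; rewrite eU inE oA.
rewrite oB wE eU (cenX2B dAB hA hB) // cA -?pE (hB o oB) /phi.
by field; rewrite p0.
Qed.

(* If [U] splits, the first-order conditions at the two pieces match because [section_val] is then
   [cenX U o] times a square. *)
Lemma local_big_big b c o U V : (0 < b)%N -> (0 < c)%N -> b != c ->
  #|U| = (b + c)%N -> #|V| = (b + c)%N -> o \in U -> [disjoint U & V] ->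
  exists g : S, forall x A B E z u v, [disjoint B & E] ->
    (U = A /\ V = B :|: E) \/ (V = A /\ U = B :|: E) ->
    #|B| = b -> #|E| = c -> const_on x A z -> const_on x B u -> const_on x E v ->
    g.@[x] = section_val b c o A B z u v.
Proof.
move=> b0 c0 bc cU cV oU dUV.
have [p pE] : exists p : C, p = b%:R by exists b%:R.
have [q qE] : exists q : C, q = c%:R by exists c%:R.
have p0 : p != 0 by rewrite ?pE ?qE pnatr_eq0; lia.
have q0 : q != 0 by rewrite ?pE ?qE pnatr_eq0; lia.
have pq0 : p + q != 0 by rewrite pE qE -natrD pnatr_eq0; lia.
have pmq0 : q - p != 0 by rewrite pE qE; apply: natr_neq; rewrite eq_sym.
have /card_gt0P [k kV] : (0 < #|V|)%N by rewrite cV; lia.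
pose D2 : S := (p * q * (p + q))^-1%:MP * cenS U 2.
have D2E x B E u v : [disjoint B & E] -> U = B :|: E ->
    #|B| = b -> #|E| = c -> const_on x B u -> const_on x E v -> D2.@[x] = (u - v) ^+ 2.
  move=> dBE eU cB cE hB hE; rewrite /D2 mevalM mevalC eU (cenS2 dBE hB hE) cB cE -?pE -?qE.
  by field; rewrite p0 q0 pq0.
have D20 x z : const_on x U z -> D2.@[x] = 0.
  by move=> hU; rewrite /D2 mevalM (cenS1 1 hU) mulr0.
clearbody D2.
have [w wE] : exists w : S, w = cenX U o by exists (cenX U o).
(* [Q1] is [(u - v) * w]: on both [B] and [E] the bracket equals [(q - p) (u - v) w]. *)
pose Q1 : S := (q - p)^-1%:MP * (w ^+ 2 - (p * q)%:MP * D2).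
pose mu : S := 'X_k - (p + q)^-1%:MP * sumX U.
(* Since [mu] is [z] minus the mean of [U], [(z - u) (z - v) = mu ^ 2 - kk mu (u - v) - ee (u - v) ^
   2]. The witness is [w] times the square of this; every term carries [w] or [Q1], hence vanishes
   when [U] is [A]. *)
pose kk := (q - p) / (p + q); pose ee := p * q / (p + q) ^+ 2.
exists (mu ^+ 4 * w - (2 * kk)%:MP * (mu ^+ 3 * Q1) + (kk ^+ 2 - 2 * ee)%:MP * (mu ^+ 2 * w * D2)
  + (2 * kk * ee)%:MP * (mu * Q1 * D2) + (ee ^+ 2)%:MP * (w * D2 ^+ 2)).
move=> x A B E z u v dBE hUV cB cE hA hB hE.
rewrite /section_val; case: hUV => [[eU eV]|[eV eU]].
  have hU : const_on x U z by rewrite eU.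
  rewrite -eU oU /Q1; mevalE.
  by rewrite wE (cenX1 hU oU) (D20 _ _ hU); ring.
have oA : (o \in A) = false by rewrite -eV (disjointFr dUV).
have zk : x k = z by apply: hA; rewrite -eV.
rewrite oA; move: oU; rewrite eU inE; case: ifP => [oB _|oB /= oE].
  rewrite /Q1 /mu; mevalE; rewrite (D2E _ _ _ _ _ dBE eU cB cE hB hE) zk wE eU (sumX2 dBE hB hE) (cenX2A dBE hB hE) // cB cE -?pE -?qE /kk /ee /phi.
  by field; rewrite pq0.
rewrite /Q1 /mu; mevalE; rewrite (D2E _ _ _ _ _ dBE eU cB cE hB hE) zk wE eU (sumX2 dBE hB hE) (cenX2B dBE hB hE) // cB cE -?pE -?qE /kk /ee /phi.
by field; rewrite pq0.
Qed.

End Local.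

(** * Products of differences as denominators of the local extensions *)

Section Separation.
Variables (C : numFieldType) (n : nat).
Local Notation S := {mpoly C[n]}.
Implicit Types (x : 'I_n -> C) (A B E U V D P Q T : {set 'I_n}).

Definition sepX U V : S := \prod_(i in U) \prod_(j in V) ('X_i - 'X_j).

Lemma meval_sepX U V x : (sepX U V).@[x] = \prod_(i in U) \prod_(j in V) (x i - x j).
Proof.
rewrite /sepX rmorph_prod; apply: eq_bigr => i _; rewrite rmorph_prod.
by apply: eq_bigr => j _ /=; rewrite mevalB !mevalXU.
Qed.

Lemma sepX_neq U V x i j : (sepX U V).@[x] != 0 -> i \in U -> j \in V -> x i != x j.
Proof.
rewrite meval_sepX => /prodf_neq0 h iU jV.
by have /prodf_neq0/(_ j jV) := h i iU; rewrite subr_eq0.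
Qed.

Lemma sub_or A U V D x z : D = U :|: V -> A \subset D -> (sepX U V).@[x] != 0 -> const_on x A z ->
  A \subset U \/ A \subset V.
Proof.
move=> eD AD nz hA; have [|/subsetPn[i iA iU]] := boolP (A \subset U); first by left.
right; apply/subsetP => j jA; apply/negPn/negP => jV.
have iV : i \in V by have := subsetP AD i iA; rewrite eD inE (negbTE iU).
have jU : j \in U by have := subsetP AD j jA; rewrite eD inE (negbTE jV) orbF.
by have := sepX_neq nz jU iV; rewrite (hA i iA) (hA j jA) eqxx.
Qed.

Lemma split_eq U V P Q : U :|: V = P :|: Q -> [disjoint U & V] -> P \subset U -> Q \subset V ->
  U = P /\ V = Q.
Proof.
move=> e dUV /subsetP hP /subsetP hQ; split; apply/setP => i; apply/idP/idP; auto.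
  move=> iU; have : i \in P :|: Q by rewrite -e inE iU.
  by rewrite inE => /orP[//|/hQ]; rewrite (disjointFr dUV iU).
move=> iV; have : i \in P :|: Q by rewrite -e inE iV orbT.
by rewrite inE => /orP[/hP|//]; rewrite (disjointFl dUV iV).
Qed.

Lemma disjoint_setU A B E : [disjoint A & E] -> [disjoint B & E] -> [disjoint A :|: B & E].
Proof. by rewrite -!setI_eq0 setIUl => /eqP -> /eqP ->; rewrite setU0. Qed.

Lemma card_disjU A B : [disjoint A & B] -> #|A :|: B| = (#|A| + #|B|)%N.
Proof. by move=> d; rewrite cardsU (disjoint_setI0 d) cards0 subn0. Qed.

(** Exchanging [B] and [E] changes the sign of [phi] and swaps the weights [c] and [- b]. This
    reduces a separated block of size [b] to one of size [c]. *)
Lemma Fval_swap b c o D A B E (z u v : C) : three_blocks b c D A B E -> o \in D ->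
  section_val b c o A B z u v = section_val c b o A E z v u.
Proof.
case=> -> [d1 d2 d3] _; rewrite !inE /section_val /phi.
case: (boolP (o \in A)) => //= oA; case: (boolP (o \in B)) => /= oB.
  by rewrite (disjointFr d3 oB) => _; ring.
by move=> ->; ring.
Qed.

Lemma sep_cases b c D A B E U V x z u v : (0 < b)%N -> (0 < c)%N -> b != c ->
  three_blocks b c D A B E -> D = U :|: V -> [disjoint U & V] ->
  const_on x A z -> const_on x B u -> const_on x E v -> (sepX U V).@[x] != 0 ->
  [/\ #|V| = c -> U = A :|: B /\ V = E,
      #|V| = b -> U = A :|: E /\ V = B &
      #|V| = (b + c)%N -> (U = A /\ V = B :|: E) \/ (V = A /\ U = B :|: E)].
Proof.
move=> b0 c0 bc [eD [d1 d2 d3] [c1 c2 c3]] eUV dUV hA hB hE nz.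
have sA : A \subset D by rewrite eD -setUA subsetUl.
have sB : B \subset D by rewrite eD setUAC subsetUr.
have sE : E \subset D by rewrite eD subsetUr.
have dABE : [disjoint A :|: B & E] by apply: disjoint_setU.
have dAEB : [disjoint A :|: E & B] by apply: disjoint_setU; rewrite // disjoint_sym.
have fin P Q : D = P :|: Q -> P \subset U -> Q \subset V -> U = P /\ V = Q.
  by move=> e; apply: split_eq => //; rewrite -eUV e.
have cD : #|D| = (b + c + b + c)%N by rewrite eD !card_disjU // c1 c2 c3.
have cUV : #|D| = (#|U| + #|V|)%N by rewrite eUV card_disjU.
have bc' : b <> c by apply/eqP.
(* Each block lies entirely in [U] or in [V]; the size of [V] then decides among the eight
   distributions. *)
have [hA'|hA'] := sub_or eUV sA nz hA; have [hB'|hB'] := sub_or eUV sB nz hB;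
  have [hE'|hE'] := sub_or eUV sE nz hE.
- have [|||eU eV] := fin D set0; rewrite ?setU0 ?sub0set //.
    by rewrite eD !subUset hA' hB' hE'.
  by rewrite eV cards0; split=> h; exfalso; clear -b0 c0 bc' h; lia.
- have [|||eU eV] := fin (A :|: B) E; rewrite ?subUset ?hA' ?hB' //.
  by rewrite eV c3; split=> // h; exfalso; clear -b0 c0 bc' h; lia.
- have [|||eU eV] := fin (A :|: E) B; rewrite ?subUset ?hA' ?hE' // 1?setUAC //.
  by rewrite eV c2; split=> // h; exfalso; clear -b0 c0 bc' h; lia.
- have [|||eU eV] := fin A (B :|: E); rewrite ?subUset ?hB' ?hE' // ?setUA //.
  rewrite eV card_disjU // c2 c3; split=> h; last (by left); exfalso; clear -b0 c0 bc' h; lia.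
- have [|||eU eV] := fin (B :|: E) A; rewrite ?subUset ?hB' ?hE' // 1?setUC ?setUA //.
  rewrite eV c1; split=> h; last (by right); exfalso; clear -b0 c0 bc' h; lia.
- have [|||eU eV] := fin B (A :|: E); rewrite ?subUset ?hA' ?hE' // 1?setUC ?setUA 1?setUAC //.
  by rewrite eV card_disjU // c1 c3; split=> h; exfalso; clear -b0 c0 bc' h; lia.
- have [|||eU eV] := fin E (A :|: B); rewrite ?subUset ?hA' ?hB' // 1?setUC //.
  by rewrite eV card_disjU // c1 c2; split=> h; exfalso; clear -b0 c0 bc' h; lia.
- have [|||eU eV] := fin set0 D; rewrite ?set0U ?sub0set //.
    by rewrite eD !subUset hA' hB' hE'.
  by rewrite eV cD; split=> h; exfalso; clear -b0 c0 bc' h; lia.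
Qed.

Lemma sep_local b c o U V D : (0 < b)%N -> (0 < c)%N -> b != c -> #|D| = (b + c + b + c)%N ->
  D = U :|: V -> [disjoint U & V] -> o \in D -> [\/ #|V| = b, #|V| = c | #|V| = (b + c)%N] ->
  exists g : S, forall x A B E z u v, three_blocks b c D A B E -> const_on x A z -> const_on x B u -> const_on x E v ->
    (sepX U V).@[x] * section_val b c o A B z u v = (sepX U V).@[x] * g.@[x].
Proof.
move=> b0 c0 bc cD eD dUV oD hV.
have cUV : #|D| = (#|U| + #|V|)%N by rewrite eD card_disjU.
have oUV : o \in U :|: V by rewrite -eD.
case: hV => cV.
- have V0 : (0 < #|V|)%N by rewrite cV.
  have [g hg] := @local_big_small C n c b o U V c0 b0 V0 oUV dUV.
  exists g => x A B E z u v ht hA hB hE.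
  have [->|nz] := eqVneq (sepX U V).@[x] 0; first by rewrite !mul0r.
  have [_ /(_ cV) [eU eV] _] := sep_cases b0 c0 bc ht eD dUV hA hB hE nz.
  case: (ht) => _ [d1 d2 d3] [c1 c2 c3].
  by rewrite (Fval_swap _ _ _ ht oD) (hg x A E z v u) // ?eV // addnC.
- have V0 : (0 < #|V|)%N by rewrite cV.
  have [g hg] := @local_big_small C n b c o U V b0 c0 V0 oUV dUV.
  exists g => x A B E z u v ht hA hB hE.
  have [->|nz] := eqVneq (sepX U V).@[x] 0; first by rewrite !mul0r.
  have [/(_ cV) [eU eV] _ _] := sep_cases b0 c0 bc ht eD dUV hA hB hE nz.
  case: (ht) => _ [d1 d2 d3] [c1 c2 c3].
  by rewrite (hg x A B z u v) // eV.
- have cU : #|U| = (b + c)%N by lia.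
  have [oU|oV] := boolP (o \in U).
    have [g hg] := @local_big_big C n b c o U V b0 c0 bc cU cV oU dUV.
    exists g => x A B E z u v ht hA hB hE.
    have [->|nz] := eqVneq (sepX U V).@[x] 0; first by rewrite !mul0r.
    have [_ _ /(_ cV) hUV] := sep_cases b0 c0 bc ht eD dUV hA hB hE nz.
    case: (ht) => _ [d1 d2 d3] [c1 c2 c3].
    by rewrite (hg x A B E z u v).
  have {}oV : o \in V by move: oUV; rewrite inE (negbTE oV).
  rewrite disjoint_sym in dUV.
  have [g hg] := @local_big_big C n b c o V U b0 c0 bc cV cU oV dUV.
  exists g => x A B E z u v ht hA hB hE.
  have [->|nz] := eqVneq (sepX U V).@[x] 0; first by rewrite !mul0r.
  rewrite disjoint_sym in dUV.
  have [_ _ /(_ cV) hUV] := sep_cases b0 c0 bc ht eD dUV hA hB hE nz.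
  case: (ht) => _ [d1 d2 d3] [c1 c2 c3].
  by rewrite (hg x A B E z u v) //; case: hUV => -[-> ->]; [right|left].
Qed.

(** Every term of the binomial expansion is divisible by [be ^+ p] or by [ga ^+ q]; the induction
    splits off one factor [be - ga] at a time. *)
Lemma ideal_pow_sub (J : S -> Prop) (d be ga : S) p q : ideal_like J ->
  J (d * be ^+ p) -> J (d * ga ^+ q) -> J (d * (be - ga) ^+ (p + q)).
Proof.
move=> idJ; case: (idJ) => J0 JD JM.
elim: p d q => [|p IHp] d q.
  by rewrite expr0 mulr1 => Jd _; rewrite mulrC; apply: JM.
elim: q d => [|q IHq] d h1 h2.
  by rewrite expr0 mulr1 in h2; rewrite mulrC; apply: JM.
have k1 : J (d * be * (be - ga) ^+ (p + q.+1)).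
  apply: IHp; first by rewrite -mulrA -exprS.
  by rewrite mulrAC mulrC; apply: JM.
have k2 : J (d * ga * (be - ga) ^+ (p.+1 + q)).
  apply: IHq; last by rewrite -mulrA -exprS.
  by rewrite mulrAC mulrC; apply: JM.
have -> : d * (be - ga) ^+ (p.+1 + q.+1) =
   d * be * (be - ga) ^+ (p + q.+1) + (-1) * (d * ga * (be - ga) ^+ (p.+1 + q)).
  by rewrite addSn exprS -addSnnS; ring.
by apply: JD => //; apply: JM.
Qed.

Lemma sepX_on2 P Q T x p q t : [disjoint Q & T] -> const_on x P p -> const_on x Q q -> const_on x T t ->
  (sepX (Q :|: T) P).@[x] = (q - p) ^+ (#|P| * #|Q|) * (t - p) ^+ (#|P| * #|T|).
Proof.
move=> dQT hP hQ hT; rewrite meval_sepX.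
rewrite (eq_bigl [predU Q & T]) => [|i]; last by rewrite !inE.
rewrite bigU //=; congr (_ * _).
  rewrite (eq_bigr (fun=> (q - p) ^+ #|P|)) ?prodr_const ?exprM // => i iQ.
  by rewrite (eq_bigr (fun=> q - p)) ?prodr_const // => j jP; rewrite hQ // hP.
rewrite (eq_bigr (fun=> (t - p) ^+ #|P|)) ?prodr_const ?exprM // => i iQ.
by rewrite (eq_bigr (fun=> t - p)) ?prodr_const // => j jP; rewrite hT // hP.
Qed.

(** On such a component the two products are, up to sign, a power of [p - q] times a power of
    [t - p] and of [t - q] respectively. The difference of these last two is again [p - q] up to
    sign, which eliminates [t]. *)
Lemma pow_in_blocks (J : S -> Prop) P Q T i j k : ideal_like J ->
  [disjoint Q & T] -> [disjoint P & T] -> J (sepX (Q :|: T) P) -> J (sepX (P :|: T) Q) ->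
  i \in P -> j \in Q -> k \in T ->
  exists N, exists2 a, J a & forall x p q t, const_on x P p -> const_on x Q q -> const_on x T t ->
    (x i - x j) ^+ N = a.@[x].
Proof.
move=> idJ dQT dPT J1 J2 iP jQ kT; case: (idJ) => J0 JD JM.
pose J' m := exists2 a, J a & forall x p q t, const_on x P p -> const_on x Q q -> const_on x T t -> m.@[x] = a.@[x] :> C.
have idJ' : ideal_like J'.
  split; first by exists 0.
    move=> m m' [a Ja ha] [a' Ja' ha']; exists (a + a') => [|x p q t h1 h2 h3]; first exact: JD.
    by rewrite !mevalD (ha x p q t) // (ha' x p q t).
  move=> m m' [a Ja ha]; exists (m * a) => [|x p q t h1 h2 h3]; first exact: JM.
  by rewrite !mevalM (ha x p q t).
pose d : S := ('X_i - 'X_j) ^+ (#|P| * #|Q|).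
have K1 : J' (d * ('X_k - 'X_j) ^+ (#|Q| * #|T|)).
  exists (sepX (P :|: T) Q) => // x p q t h1 h2 h3.
  rewrite (sepX_on2 dPT h2 h1 h3) mevalM /d !rmorphXn /= !mevalB !mevalXU.
  by rewrite (h1 i) // (h2 j) // (h3 k) // [(#|Q| * #|P|)%N]mulnC.
have K2 : J' (d * ('X_k - 'X_i) ^+ (#|P| * #|T|)).
  exists ((-1) ^+ (#|P| * #|Q|) * sepX (Q :|: T) P) => [|x p q t h1 h2 h3]; first exact: JM.
  rewrite [RHS]mevalM (sepX_on2 dQT h1 h2 h3) mevalM /d !rmorphXn /= !mevalB !mevalXU.
  rewrite (h1 i) // (h2 j) // (h3 k) // mulrA -exprMn; congr (_ ^+ _ * _).
  by rewrite mevalN meval1 mulN1r opprB.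
have [a Ja ha] := ideal_pow_sub idJ' K1 K2.
exists (#|P| * #|Q| + (#|Q| * #|T| + #|P| * #|T|))%N, a => // x p q t h1 h2 h3.
rewrite -(ha x p q t) // exprD mevalM /d !rmorphXn /= !mevalB !mevalXU.
by congr (_ * _ ^+ _); rewrite (h1 i) // (h2 j) // (h3 k) //; ring.
Qed.

Lemma pow_in_tri (J : S -> Prop) b c D A B E i j : ideal_like J -> (0 < b)%N -> (0 < c)%N ->
  three_blocks b c D A B E -> i \in D -> j \in D ->
  (forall U V, D = U :|: V -> [disjoint U & V] -> [\/ #|V| = b, #|V| = c | #|V| = (b + c)%N] ->
     J (sepX U V)) ->
  exists N, exists2 a, J a & forall x z u v, const_on x A z -> const_on x B u -> const_on x E v ->
    (x i - x j) ^+ N = a.@[x].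
Proof.
move=> idJ b0 c0 [eD [d1 d2 d3] [c1 c2 c3]] iD jD hJ; case: (idJ) => J0 JD JM.
have [kA hkA] : exists k, k \in A by apply/card_gt0P; rewrite c1; lia.
have [kB hkB] : exists k, k \in B by apply/card_gt0P; rewrite c2.
have [kE hkE] : exists k, k \in E by apply/card_gt0P; rewrite c3.
have d1' : [disjoint B & A] by rewrite disjoint_sym.
have d2' : [disjoint E & A] by rewrite disjoint_sym.
have d3' : [disjoint E & B] by rewrite disjoint_sym.
have JA : J (sepX (B :|: E) A).
  by apply: hJ; [rewrite eD -setUA setUC | exact: disjoint_setU | rewrite c1; apply: Or33].
have JB : J (sepX (A :|: E) B).
  by apply: hJ; [rewrite eD setUAC | exact: disjoint_setU | rewrite c2; apply: Or31].
have JE : J (sepX (A :|: B) E).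
  by apply: hJ; [rewrite eD | exact: disjoint_setU | rewrite c3; apply: Or32].
have same P : i \in P -> j \in P -> exists N, exists2 a, J a & forall x z, const_on x P z -> (x i - x j) ^+ N = a.@[x].
  by move=> iP jP; exists 1%N, 0 => // x z hz; rewrite (hz i) // (hz j) // subrr meval0 expr1.
have JA' : J (sepX (E :|: B) A) by rewrite setUC.
have JB' : J (sepX (E :|: A) B) by rewrite setUC.
have JE' : J (sepX (B :|: A) E) by rewrite setUC.
move: iD jD; rewrite eD !inE -!orbA => /or3P[] hi /or3P[] hj.
- by have [N [a Ja ha]] := same A hi hj; exists N, a => // x z u v h1 h2 h3; apply: ha h1.
- have [N [a Ja ha]] := pow_in_blocks idJ d3 d2 JA JB hi hj hkE.
  by exists N, a => // x z u v h1 h2 h3; apply: ha h1 h2 h3.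
- have [N [a Ja ha]] := pow_in_blocks idJ d3' d1 JA' JE hi hj hkB.
  by exists N, a => // x z u v h1 h2 h3; apply: ha h1 h3 h2.
- have [N [a Ja ha]] := pow_in_blocks idJ d2 d3 JB JA hi hj hkE.
  by exists N, a => // x z u v h1 h2 h3; apply: ha h2 h1 h3.
- by have [N [a Ja ha]] := same B hi hj; exists N, a => // x z u v h1 h2 h3; apply: ha h2.
- have [N [a Ja ha]] := pow_in_blocks idJ d2' d1' JB' JE' hi hj hkA.
  by exists N, a => // x z u v h1 h2 h3; apply: ha h2 h3 h1.
- have [N [a Ja ha]] := pow_in_blocks idJ d1 d3' JE JA' hi hj hkB.
  by exists N, a => // x z u v h1 h2 h3; apply: ha h3 h1 h2.
- have [N [a Ja ha]] := pow_in_blocks idJ d1' d2' JE' JB' hi hj hkA.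
  by exists N, a => // x z u v h1 h2 h3; apply: ha h3 h2 h1.
- by have [N [a Ja ha]] := same E hi hj; exists N, a => // x z u v h1 h2 h3; apply: ha h3.
Qed.

(* The product over all components of the differences [(x_i - x_j)^N - a] vanishes on their
   union. *)
Lemma pow_in_all (J : S -> Prop) b c D i j : ideal_like J -> (0 < b)%N -> (0 < c)%N ->
  i \in D -> j \in D ->
  (forall U V, D = U :|: V -> [disjoint U & V] -> [\/ #|V| = b, #|V| = c | #|V| = (b + c)%N] ->
     J (sepX U V)) ->
  exists N, exists2 a, J a & forall x A B E z u v, three_blocks b c D A B E ->
    const_on x A z -> const_on x B u -> const_on x E v -> (x i - x j) ^+ N = a.@[x].
Proof.
move=> idJ b0 c0 iD jD hJ; case: (idJ) => J0 JD JM.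
pose Tr := ({set 'I_n} * {set 'I_n} * {set 'I_n})%type.
have H (L : seq Tr) : exists N, exists2 a, J a & forall t x z u v, t \in L ->
    three_blocks b c D t.1.1 t.1.2 t.2 -> const_on x t.1.1 z -> const_on x t.1.2 u -> const_on x t.2 v ->
    (x i - x j) ^+ N = a.@[x].
  elim: L => [|t0 L [N [a Ja ha]]]; first by exists 0%N, 0.
  have [M [a' Ja' ha']] : exists M, exists2 a, J a & forall x z u v,
      three_blocks b c D t0.1.1 t0.1.2 t0.2 -> const_on x t0.1.1 z -> const_on x t0.1.2 u -> const_on x t0.2 v ->
      (x i - x j) ^+ M = a.@[x].
    have [ht|nt] := classic (three_blocks b c D t0.1.1 t0.1.2 t0.2); last by exists 0%N, 0.
    have [M [a' Ja' ha']] := pow_in_tri idJ b0 c0 ht iD jD hJ.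
    by exists M, a' => // x z u v _; apply: ha'.
  pose l : S := 'X_i - 'X_j.
  exists (N + M)%N, (l ^+ M * a + l ^+ N * a' + (- a) * a').
    by apply: (JD); [apply: (JD) |]; apply: JM.
  move=> t x z u v; rewrite inE => ht htri h1 h2 h3.
  rewrite !mevalD !mevalM /l !rmorphXn mevalN /= mevalB !mevalXU exprD.
  case/orP: ht => [/eqP et|ht].
    by rewrite et in htri h1 h2 h3; rewrite -(ha' x z u v) //; ring.
  by rewrite -(ha t x z u v) //; ring.
have [N [a Ja ha]] := H (enum {: Tr}).
by exists N, a => // x A B E z u v; apply: (ha (A, B, E)); rewrite mem_enum.
Qed.

End Separation.

(** * The section does not extend *)

Section Quintic.
Variable C : numFieldType.

Lemma poly5_eq0 (a0 a1 a2 a3 a4 a5 : C) :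
  (forall t, a0 + a1 * t + a2 * t ^+ 2 + a3 * t ^+ 3 + a4 * t ^+ 4 + a5 * t ^+ 5 = 0) ->
  [/\ a0 = 0, a1 = 0, a2 = 0 & [/\ a3 = 0, a4 = 0 & a5 = 0]].
Proof.
move=> h; pose s := [:: a0; a1; a2; a3; a4; a5].
have h0 : Poly s = 0.
  apply: poly_eq0_fun => t _; rewrite horner_Poly /= -[RHS](h t); ring.
have hc i : s`_i = 0 by rewrite -coef_Poly h0 coef0.
by split; [exact: (hc 0%N)|exact: (hc 1%N)|exact: (hc 2)|
  split; [exact: (hc 3)|exact: (hc 4)|exact: (hc 5)]].
Qed.

(** Linear elimination by certificates: [lin2] combines two known equations, [ring] checks the
    combination, and the scalar [k] is cancelled. *)
Lemma lin_comb (k x y u v : C) : k != 0 -> u = v -> k * (x - y) = u - v -> x = y.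
Proof.
move=> k0 -> /eqP; rewrite subrr mulf_eq0 (negbTE k0) /= subr_eq0 => /eqP //.
Qed.

Lemma lin2 (a b c d : C) : a = b -> c = d -> forall s t, s * a + t * c = s * b + t * d.
Proof. by move=> -> -> s t. Qed.

(* The general quintic in [w] and the power sums [P k] when [P 1 = 0]. *)
Definition quintic (q0 q2 q3 q4 q22 q5 q23 w : C) (P : nat -> C) :=
  q0 * w ^+ 5 + q2 * (P 2 * w ^+ 3) + q3 * (P 3 * w ^+ 2) + q4 * (P 4 * w)
  + q22 * (P 2 ^+ 2 * w) + q5 * P 5 + q23 * (P 2 * P 3).

(** The values [1], [u t], [v t] parametrize, with [z] normalized to 1, the triples whose first
    power sum is zero. The hypotheses are the cases of [o] in [A], [B], [E]; their coefficients in
    [t] give an inconsistent linear system for the seven unknowns. *)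
Lemma quintic_obstruction (b c K q0 q2 q3 q4 q22 q5 q23 : C) :
  0 < b -> 0 < c -> b != c -> K != 0 ->
  let u t := - 1 + c * t in let v t := - 1 - b * t in
  let P t k := (b + c) * 1 ^+ k + b * u t ^+ k + c * v t ^+ k in
  let f t := (2 - c * t) ^+ 2 * (2 + b * t) ^+ 2 * ((b + c) * t) in
  (forall t, quintic q0 q2 q3 q4 q22 q5 q23 1 (P t) = 0) ->
  (forall t, quintic q0 q2 q3 q4 q22 q5 q23 (u t) (P t) = K * (c * f t)) ->
  (forall t, quintic q0 q2 q3 q4 q22 q5 q23 (v t) (P t) = K * (- b * f t)) -> False.
Proof.
move=> b0 c0 bc K0 u v P f hA hB hE.
have bn : b != 0 by rewrite gt_eqF. have cn : c != 0 by rewrite gt_eqF.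
pose N := b + c; pose p := b * c * N; pose r3 := c - b; pose r4 := b ^+ 2 - b * c + c ^+ 2.
pose r5 := r3 * (b ^+ 2 + c ^+ 2).
have Nn : b + c != 0 by rewrite gt_eqF // addr_gt0.
have pn : b * c * (b + c) != 0 by rewrite !mulf_neq0.
have rn : c - b != 0 by rewrite subr_eq0 eq_sym.
have P2 t : P t 2 = 2 * N + p * t ^+ 2 by rewrite /P /u /v /p /N; ring.
have P3 t : P t 3 = - 3 * p * t ^+ 2 + p * r3 * t ^+ 3 by rewrite /P /u /v /p /N /r3; ring.
have P4 t : P t 4 = 2 * N + 6 * p * t ^+ 2 - 4 * p * r3 * t ^+ 3 + p * r4 * t ^+ 4.
  by rewrite /P /u /v /p /N /r3 /r4; ring.
have P5 t : P t 5 = - 10 * p * t ^+ 2 + 10 * p * r3 * t ^+ 3 - 5 * p * r4 * t ^+ 4 + p * r5 * t ^+ 5.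
  by rewrite /P /u /v /p /N /r3 /r4 /r5 /r3; ring.
(* The entry [0 = 0] is the coefficient of [t], which vanishes identically. *)
have [A0 _ A2 [A3 A4 A5]] : [/\ q0 + 2 * N * q2 + 2 * N * q4 + 4 * N ^+ 2 * q22 = 0, 0 = 0 :> C,
    p * (q2 - 3 * q3 + 6 * q4 + 4 * N * q22 - 10 * q5 - 6 * N * q23) = 0 &
    [/\ p * r3 * (q3 - 4 * q4 + 10 * q5 + 2 * N * q23) = 0,
     p * (r4 * q4 + p * q22 - 5 * r4 * q5 - 3 * p * q23) = 0 &
     p * r3 * ((b ^+ 2 + c ^+ 2) * q5 + p * q23) = 0]].
  apply: poly5_eq0 => t; rewrite -[RHS](hA t) /quintic P2 P3 P4 P5 /r5; ring.
(* The conditions at [B] and [E] are one identity with [e = c] and [e = - b]; of its coefficients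
   those of [t] and [t ^ 2] are kept. *)
have mid e : (forall t, quintic q0 q2 q3 q4 q22 q5 q23 (- 1 + e * t) (P t) = K * (e * f t)) ->
    e * (5 * q0 + 6 * N * q2 + 2 * N * q4 + 4 * N ^+ 2 * q22 - 16 * N * K) = 0 /\
    - e ^+ 2 * (10 * q0 + 6 * N * q2) - p * (q2 + 3 * q3 + 6 * q4 + 4 * N * q22 + 10 * q5 + 6 * N * q23)
      - 16 * e * N * (b - c) * K = 0.
  move=> h; pose d := b - c.
  have [_ e1 e2 _] : [/\
      - (q0 + 2 * N * q2 + 2 * N * q4 + 4 * N ^+ 2 * q22) = 0,
      e * (5 * q0 + 6 * N * q2 + 2 * N * q4 + 4 * N ^+ 2 * q22 - 16 * N * K) = 0,
      - e ^+ 2 * (10 * q0 + 6 * N * q2) - p * (q2 + 3 * q3 + 6 * q4 + 4 * N * q22 + 10 * q5 + 6 * N * q23)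
      - 16 * e * N * (b - c) * K = 0 &
    [/\ 10 * e ^+ 3 * q0 + (2 * N * e ^+ 3 + 3 * e * p) * q2 + p * (6 * e + r3) * q3 + (6 * p * e + 4 * p * r3) * q4
        + 4 * N * p * e * q22 + 10 * p * r3 * q5 + 2 * N * p * r3 * q23
        - K * e * N * (4 * d ^+ 2 - 8 * b * c) = 0,
      - 5 * e ^+ 4 * q0 - 3 * e ^+ 2 * p * q2 - p * (3 * e ^+ 2 + 2 * e * r3) * q3 - (4 * p * r3 * e + p * r4) * q4
        - p ^+ 2 * q22 - 5 * p * r4 * q5 - 3 * p ^+ 2 * q23 + K * e * N * 4 * b * c * d = 0 &
      e ^+ 5 * q0 + e ^+ 3 * p * q2 + p * r3 * e ^+ 2 * q3 + p * r4 * e * q4 + p ^+ 2 * e * q22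
        + p * r5 * q5 + p ^+ 2 * r3 * q23 - K * e * N * b ^+ 2 * c ^+ 2 = 0]].
    apply: poly5_eq0 => t.
    have /eqP := h t; rewrite -subr_eq0 => /eqP ht; rewrite -[RHS]ht /quintic P2 P3 P4 P5 /d /f /r5 /N; ring.
  by split.
have [B1 B2] := mid c hB.
have [|_ E2] := mid (- b); first by move=> t; rewrite -hE /v mulNr.
move: Nn pn; rewrite -/N -/p => Nn pn.
have n0 k : (k.+1%:R : C) != 0 by rewrite pnatr_eq0.
have D1 : 10 * q0 + 6 * N * q2 = 16 * N * K.
  apply: (@lin_comb (N * (b - c)) _ _ _ _ _ (lin2 E2 B2 (-1) 1)); last by rewrite /N; ring.
  by rewrite mulf_neq0 // subr_eq0.
have B1' : 5 * q0 + 6 * N * q2 + 2 * N * q4 + 4 * N ^+ 2 * q22 = 16 * N * K.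
  by apply: (lin_comb cn B1); ring.
have G : q2 + 3 * q3 + 6 * q4 + 4 * N * q22 + 10 * q5 + 6 * N * q23 = - 16 * K.
  by apply: (lin_comb (k := - p) _ (lin2 B2 D1 1 (c ^+ 2))); rewrite ?oppr_eq0 // /p /N; ring.
have A2' := lin_comb pn (x := q2 - 3 * q3 + 6 * q4 + 4 * N * q22 - 10 * q5 - 6 * N * q23) (y := 0) A2.
have {A2'} A2' : q2 - 3 * q3 + 6 * q4 + 4 * N * q22 - 10 * q5 - 6 * N * q23 = 0 by apply: A2'; ring.
have prn : p * r3 != 0 by rewrite mulf_neq0.
have A3' : q3 - 4 * q4 + 10 * q5 + 2 * N * q23 = 0 by apply: (lin_comb prn A3); ring.
have A5' : (b ^+ 2 + c ^+ 2) * q5 + p * q23 = 0 by apply: (lin_comb prn A5); ring.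
have A4' : r4 * q4 + p * q22 - 5 * r4 * q5 - 3 * p * q23 = 0 by apply: (lin_comb pn A4); ring.
have H1 : q2 + 6 * q4 + 4 * N * q22 = - 8 * K by apply: (lin_comb (n0 1%N) (lin2 G A2' 1 1)); ring.
have H2 : 3 * q3 + 10 * q5 + 6 * N * q23 = - 8 * K by apply: (lin_comb (n0 1%N) (lin2 G A2' 1 (-1))); ring.
have H3 : q2 + 2 * q4 + 4 * N * q22 = - 4 * K.
  by apply: (lin_comb (k := - (4 * N)) _ (lin2 B1' A0 1 (- 5))); rewrite ?oppr_eq0 ?mulf_neq0 //; ring.
have e4 : q4 = - K by apply: (lin_comb (n0 3) (lin2 H1 H3 1 (-1))); ring.
have H4 : 7 * q2 + 10 * q4 + 20 * N * q22 = - 8 * K.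
  by apply: (lin_comb (k := - (2 * N)) _ (lin2 D1 A0 1 (- 10))); rewrite ?oppr_eq0 ?mulf_neq0 //; ring.
have e2 : q2 = 6 * K by apply: (lin_comb (n0 1%N) (lin2 H4 H3 1 (- 5))); ring.
have e22 : N * q22 = - 2 * K.
  by apply: (lin_comb (n0 3) (lin2 H3 (esym e2) 1 1)); rewrite e4; ring.
have e5 : - 5 * q5 = K.
  by apply: (lin_comb (n0 3) (lin2 H2 A3' 1 (- 3))); rewrite e4; ring.
have e23 : 5 * p * q23 = (b ^+ 2 + c ^+ 2) * K.
  by apply: (lin_comb (oner_neq0 C) (lin2 A5' e5 5 (b ^+ 2 + c ^+ 2))); ring.
have pos : 0 < 10 * (b * c) + 3 * b ^+ 2 + 3 * c ^+ 2.
  by rewrite !addr_gt0 // ?mulr_gt0 ?exprn_gt0 ?ltr0n.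
suff : (10 * (b * c) + 3 * b ^+ 2 + 3 * c ^+ 2) * K = 0.
  by move/eqP; rewrite mulf_eq0 (negbTE K0) orbF gt_eqF.
(* After substitution the two [r4] terms of [A4'] cancel and [- 2 b c K - 3/5 (b^2 + c^2) K = 0]
   remains; the combination is this times [- 5]. *)
apply: (lin_comb (oner_neq0 C) (lin2 (lin2 A4' e22 (- 5) (5 * (b * c))) (lin2 e5 e23 (5 * r4) (- 3)) 1 1)).
by rewrite e4 /p /r4; ring.
Qed.

End Quintic.

(** * Symmetrization over the permutations of [D] fixing [o] *)

Section Orbit.
Variables (C : numFieldType) (n : nat) (D : {set 'I_n}) (o : 'I_n).
Hypothesis oD : o \in D.
Local Notation D' := (D :\ o).
Implicit Types (X : 'I_n -> C) (m : 'I_n -> nat) (s : 'S_n).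

Definition power_sum X k := \sum_(i in D) X i ^+ k.

(** The weighted homogeneous polynomials of weight [k] in [X o] and the power sums over [D],
    regarded as functions of the point. *)
Inductive weight_span : nat -> (('I_n -> C) -> C) -> Prop :=
| ws_cst a : weight_span 0 (fun=> a)
| ws_add k f g : weight_span k f -> weight_span k g -> weight_span k (fun X => f X + g X)
| ws_scale k a f : weight_span k f -> weight_span k (fun X => a * f X)
| ws_o k f : weight_span k f -> weight_span k.+1 (fun X => X o * f X)
| ws_P j k f : weight_span k f -> weight_span (j + k) (fun X => power_sum X j * f X)
| ws_ext k f g : (forall X, f X = g X) -> weight_span k f -> weight_span k g.

Lemma ws_zero k : weight_span k (fun=> 0).
Proof.
have h : weight_span k (fun X => X o ^+ k).
  elim: k => [|k IH]; first exact: (ws_cst 1).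
  by apply: ws_ext (ws_o IH) => X; rewrite exprS.
by apply: ws_ext (ws_scale 0 h) => X; rewrite mul0r.
Qed.

Lemma ws_sum k (I : Type) (r : seq I) (Q : pred I) (f : I -> ('I_n -> C) -> C) :
  (forall i, Q i -> weight_span k (f i)) -> weight_span k (fun X => \sum_(i <- r | Q i) f i X).
Proof.
move=> h; elim: r => [|i r IH]; first by apply: ws_ext (ws_zero k) => X; rewrite big_nil.
have [Qi|nQ] := boolP (Q i).
  by apply: ws_ext (ws_add (h i Qi) IH) => X; rewrite big_cons Qi.
by apply: ws_ext IH => X; rewrite big_cons (negbTE nQ).
Qed.

Lemma ws_oX k j f : weight_span k f -> weight_span (j + k) (fun X => X o ^+ j * f X).
Proof.
move=> hf; elim: j => [|j IH]; first by apply: ws_ext hf => X; rewrite expr0 mul1r.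
by apply: ws_ext (ws_o IH) => X; rewrite exprS mulrA.
Qed.

Definition orbit_sum m X := \sum_(s | perm_on D' s) \prod_(i in D) X (s i) ^+ m i.

Definition raise_exp m t e i := if i == t then (m i + e)%N else m i.

Lemma perm_on_o s : perm_on D' s -> s o = o.
Proof. by move=> hs; apply: (out_perm hs); rewrite !inE eqxx. Qed.

Lemma prod_bump m t e X s : t \in D ->
  \prod_(i in D) X (s i) ^+ raise_exp m t e i = X (s t) ^+ e * \prod_(i in D) X (s i) ^+ m i.
Proof.
move=> tD; rewrite (bigD1 t) //= (bigD1 t tD (F := fun i => X (s i) ^+ m i)) /=.
rewrite /raise_exp eqxx exprD mulrCA -!mulrA; congr (_ * (_ * _)).
by apply: eq_bigr => i /andP[_ /negbTE ->].
Qed.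

(* Symmetrizing a monomial with one variable fewer against a power sum. *)
Lemma orb_mul_power m e X :
  (power_sum X e - X o ^+ e) * orbit_sum m X = \sum_(t in D') orbit_sum (raise_exp m t e) X.
Proof.
have -> : power_sum X e - X o ^+ e = \sum_(t in D') X t ^+ e.
  rewrite /power_sum (bigD1 o) //= addrAC subrr add0r.
  by apply: eq_bigl => i; rewrite !inE andbC.
rewrite /orbit_sum exchange_big /= mulr_sumr; apply: eq_bigr => s hs.
rewrite (reindex_inj (@perm_inj _ s)) /= (eq_bigl (mem D')) => [|i]; last exact: perm_closed.
rewrite mulr_suml; apply: eq_bigr => t; rewrite !inE => /andP[_ tD].
by rewrite prod_bump.
Qed.

Lemma orb_move m t t' e X : t \in D' -> t' \in D' -> m t = 0%N -> m t' = 0%N ->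
  orbit_sum (raise_exp m t e) X = orbit_sum (raise_exp m t' e) X.
Proof.
move=> tD tD' mt mt'; have [->//|ne] := eqVneq t t'.
have pt : perm_on D' (tperm t t').
  apply/subsetP => i; rewrite inE => hi; by case: (tpermP t t' i) hi => [->|->|_ _] //; rewrite eqxx.
rewrite /orbit_sum (reindex_inj (mulgI (tperm t t'))) /=.
apply: eq_big => [s|s hs].
  apply/idP/idP => hs; last exact: perm_onM.
  by rewrite -(mulKg (tperm t t') s); apply: perm_onM => //; rewrite tpermV.
rewrite (reindex_inj (@perm_inj _ (tperm t t'))) /=; apply: eq_big => [i|i iD].
  by case: tpermP => [->|->|//]; move: tD tD'; rewrite !inE => /andP[_ ->] /andP[_ ->].
rewrite permM tpermK /raise_exp; congr (_ ^+ _).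
case: tpermP => [->|->|/eqP/negbTE -> /eqP/negbTE -> //].
- by rewrite eq_sym (negbTE ne) mt mt'.
- by rewrite !eqxx mt mt'.
Qed.

(** Induction on the number of coordinates other than [o] that occur. Erase the exponent [e] of one
    of them, [t], and multiply by the power sum of exponent [e] without [o]: [e] lands on a free
    position, always giving [orbit_sum m] again by [orb_move], or on an occupied one, leaving fewer
    coordinates. The number of free positions is invertible. *)
Lemma orb_wspan m : weight_span (\sum_(i in D) m i) (orbit_sum m).
Proof.
move: {2}#|[set i in D' | m i != 0%N]| (erefl #|[set i in D' | m i != 0%N]|) => k.
elim: k m => [|k IH] m hk.
  have m0 i : i \in D -> i != o -> m i = 0%N.
    move=> iD io; apply/eqP; move/eqP: hk; rewrite cards_eq0 => /eqP/setP/(_ i).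
    by rewrite !inE iD io /=; case: eqP.
  have -> : (\sum_(i in D) m i)%N = (m o + 0)%N.
    rewrite (bigD1 o) //= big1 // => i /andP[iD io]; exact: m0.
  pose c : C := \sum_(s | perm_on D' s) 1.
  apply: ws_ext (ws_oX (m o) (ws_cst c)) => X.
  rewrite /orbit_sum mulr_sumr; apply: eq_bigr => s hs; rewrite mulr1 (bigD1 o) //= perm_on_o //.
  by rewrite big1 ?mulr1 // => i /andP[iD io]; rewrite m0.
have [t] : exists t, t \in [set i in D' | m i != 0%N] by apply/card_gt0P; rewrite hk.
rewrite inE => /andP[tD' mt].
have tD : t \in D by move: tD'; rewrite inE => /andP[].
pose m' i := if i == t then 0%N else m i; pose e := m t.
have m't : m' t = 0%N by rewrite /m' eqxx.
have mE i : m i = raise_exp m' t e i by rewrite /raise_exp /m' /e; case: eqP => [->|//].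
have orbE X : orbit_sum m X = orbit_sum (raise_exp m' t e) X.
  by apply: eq_bigr => s _; apply: eq_bigr => i _; rewrite mE.
pose A := [set i in D' | m' i != 0%N].
have cA : #|A| = k.
  have : #|[set i in D' | m i != 0%N]| = #|t |: A|.
    apply: eq_card => i; rewrite !inE /m'; case: (eqVneq i t) => [->|_] //=.
    by move: tD'; rewrite !inE => ->; rewrite mt.
  by rewrite hk cardsU1 !inE m't eqxx andbF => -[].
have sumB i : i \in D -> (\sum_(j in D) raise_exp m' i e j = e + \sum_(j in D) m' j)%N.
  move=> iD; rewrite (bigD1 i) //= (bigD1 i iD (F := m')) /= /raise_exp eqxx addnA [(e + _)%N]addnC.
  by congr (_ + _)%N; apply: eq_bigr => j /andP[_ /negbTE ->].
have em : (\sum_(i in D) m i)%N = (e + \sum_(i in D) m' i)%N.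
  by rewrite -(sumB t tD); apply: eq_bigr => i _; rewrite mE.
have wA i : i \in A -> weight_span (\sum_(j in D) m j) (orbit_sum (raise_exp m' i e)).
  rewrite inE => /andP[iD' mi]; have iD : i \in D by move: iD'; rewrite inE => /andP[].
  rewrite em -(sumB i iD); apply: IH; rewrite -cA; apply: eq_card => j; rewrite !inE /raise_exp.
  by case: (j =P i) => [->|//]; rewrite addn_eq0 negb_and mi.
have IH' := IH m' cA.
pose B := D' :\: A.
have tB : t \in B by rewrite !inE m't eqxx andbF /=; move: tD'; rewrite !inE.
have cB : (#|B|%:R : C) != 0 by rewrite pnatr_eq0 -lt0n; apply/card_gt0P; exists t.
have key X : orbit_sum m X = #|B|%:R^-1 * (power_sum X e * orbit_sum m' X
     + (- 1) * (X o ^+ e * orbit_sum m' X + \sum_(i in A) orbit_sum (raise_exp m' i e) X)).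
  have := orb_mul_power m' e X; rewrite mulrBl (bigID (mem A)) /= => h.
  have h2 : \sum_(i in D' | i \notin A) orbit_sum (raise_exp m' i e) X = #|B|%:R * orbit_sum m X.
    rewrite orbE mulr_natl -sumr_const; apply: eq_big => [i|i /andP[iD' iA]].
      by rewrite !inE andbC.
    apply: orb_move => //; by move: iA; rewrite inE iD' negbK => /eqP.
  have h1 : \sum_(i in D' | i \in A) orbit_sum (raise_exp m' i e) X = \sum_(i in A) orbit_sum (raise_exp m' i e) X.
    apply: eq_bigl => i; apply/andP/idP => [[]//|iA]; split=> //.
    by move: iA; rewrite inE => /andP[].
  rewrite h1 h2 in h; apply: (mulfI cB); rewrite mulrA mulfV // mul1r.
  by rewrite mulN1r opprD addrA h addrAC subrr add0r.
rewrite em; apply: ws_ext (fun X => esym (key X)) _; apply: ws_scale.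
apply: ws_add; first exact: ws_P.
apply: ws_scale; apply: ws_add; first exact: ws_oX.
by rewrite -em; apply: ws_sum.
Qed.

End Orbit.

Section NormalForm.
Variables (C : numFieldType) (n : nat) (D : {set 'I_n}) (o : 'I_n).
Local Notation Pw := (@power_sum C n D).

(** The monomials are ordered so that multiplication by [w] preserves positions. The last branch is
    meant for weight 5. *)
Definition normal_form k (c : nat -> C) (w : C) (P : nat -> C) : C :=
  match k with
  | 0 => c 0%N
  | 1 => c 0%N * w
  | 2 => c 0%N * w ^+ 2 + c 1%N * P 2
  | 3 => c 0%N * w ^+ 3 + c 1%N * (P 2 * w) + c 2 * P 3
  | 4 => c 0%N * w ^+ 4 + c 1%N * (P 2 * w ^+ 2) + c 2 * (P 3 * w) + c 3 * P 4 + c 4 * P 2 ^+ 2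
  | _ => quintic (c 0%N) (c 1%N) (c 2) (c 3) (c 4) (c 5) (c 6) w P
  end.

Lemma nfvD k c c' w P : normal_form k c w P + normal_form k c' w P = normal_form k (fun i => c i + c' i) w P.
Proof. by case: k => [|[|[|[|[|k]]]]] /=; rewrite /quintic; ring. Qed.

Lemma nfvZ k a c w P : a * normal_form k c w P = normal_form k (fun i => a * c i) w P.
Proof. by case: k => [|[|[|[|[|k]]]]] /=; rewrite /quintic; ring. Qed.

Lemma wspan_nf k f : weight_span D o k f -> (k <= 5)%N ->
  exists c, forall X, Pw X 1 = 0 -> f X = normal_form k c (X o) (Pw X).
Proof.
pose l (s : seq C) i := s`_i.
elim=> {k f} [a|k f g _ IH1 _ IH2|k a f _ IH|k f _ IH|j k f _ IH|k f g e _ IH] hk.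
- by exists (fun=> a).
- have [c hc] := IH1 hk; have [c' hc'] := IH2 hk.
  by exists (fun i => c i + c' i) => X hX; rewrite hc // hc' // nfvD.
- have [c hc] := IH hk; exists (fun i => a * c i) => X hX; by rewrite hc // nfvZ.
- have [c hc] := IH (ltnW hk).
  (* The zeros stand at the monomials of weight [k.+1] that do not contain [w]. *)
  exists (l [:: c 0%N; (if k is 1 then 0 else c 1%N); (if k is 2 then 0 else c 2);
             (if k is 3 then 0 else c 3); (if k is 3 then 0 else c 4)]) => X hX.
  rewrite hc //; case: k hk {IH hc} => [|[|[|[|[|k]]]]] //= _; rewrite /l /= /quintic; ring.
- have [c hc] := IH (leq_trans (leq_addl _ _) hk).
  case: j hk => [|[|[|[|[|[|j]]]]]] hk.
  + exists (fun i => #|D|%:R * c i) => X hX; rewrite hc // -nfvZ; congr (_ * _).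
    by rewrite /power_sum (eq_bigr (fun=> 1)) ?sumr_const // => i _; rewrite expr0.
  + by exists (fun=> 0) => X hX; rewrite hX mul0r -(mul0r (normal_form (1 + k) c 0 (fun=> 0))) nfvZ; case: (k) => [|[|[|[|[|k']]]]] /=; rewrite /quintic; ring.
  + case: k hk hc {IH} => [|[|[|[|k]]]] hk hc //.
    * by exists (l [:: 0; c 0%N]) => X hX; rewrite hc // /l /=; ring.
    * by exists (l [:: 0; c 0%N; 0]) => X hX; rewrite hc // /l /=; ring.
    * by exists (l [:: 0; c 0%N; 0; 0; c 1%N]) => X hX; rewrite hc // /l /=; ring.
    * by exists (l [:: 0; c 0%N; 0; 0; c 1%N; 0; c 2]) => X hX; rewrite hc // /l /= /quintic; ring.
  + case: k hk hc {IH} => [|[|[|k]]] hk hc //.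
    * by exists (l [:: 0; 0; c 0%N]) => X hX; rewrite hc // /l /=; ring.
    * by exists (l [:: 0; 0; c 0%N; 0; 0]) => X hX; rewrite hc // /l /=; ring.
    * by exists (l [:: 0; 0; c 0%N; 0; 0; 0; c 1%N]) => X hX; rewrite hc // /l /= /quintic; ring.
  + case: k hk hc {IH} => [|[|k]] hk hc //.
    * by exists (l [:: 0; 0; 0; c 0%N; 0]) => X hX; rewrite hc // /l /=; ring.
    * by exists (l [:: 0; 0; 0; c 0%N; 0; 0; 0]) => X hX; rewrite hc // /l /= /quintic; ring.
  + case: k hk hc {IH} => [|k] hk hc //.
    by exists (l [:: 0; 0; 0; 0; 0; c 0%N; 0]) => X hX; rewrite hc // /l /= /quintic; ring.
  + by rewrite !addSn in hk.
- by have [c hc] := IH hk; exists c => X hX; rewrite -e hc.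
Qed.
End NormalForm.

(** * Averaging a hypothetical extension *)

Section NonExtension.
Variables (C : numFieldType) (n : nat) (D : {set 'I_n}) (o : 'I_n) (b c : nat).
Local Notation S := {mpoly C[n]}.
Hypothesis oD : o \in D.

(* The part of degree 5 in the coordinates of [D], the other coordinates being specialized to [ka]. *)
Definition specialize (ka X : 'I_n -> C) (h : S) : {poly C} :=
  mmap polyC (fun i => if i \in D then X i *: 'X else (ka i)%:P) h.

Lemma spec_ext ka X Y h : X =1 Y -> specialize ka X h = specialize ka Y h.
Proof.
by move=> e; apply: eq_bigr => m _; congr (_ * _); apply: mmap1_eq => i; rewrite e.
Qed.

Lemma spec_coef ka X h k : (specialize ka X h)`_k = \sum_(m <- msupp h)
  h@_m * (\prod_(i | i \notin D) ka i ^+ m i) *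
    ((\sum_(i in D) m i == k)%N%:R * \prod_(i in D) X i ^+ m i).
Proof.
rewrite /specialize /mmap coef_sum; apply: eq_bigr => m _; rewrite coefCM -mulrA; congr (_ * _).
rewrite /mmap1 (bigID (mem D)) /= mulrC.
have -> : \prod_(i | i \notin D) (if i \in D then X i *: 'X else (ka i)%:P) ^+ m i
   = (\prod_(i | i \notin D) ka i ^+ m i)%:P.
  by rewrite rmorph_prod; apply: eq_bigr => i /negbTE ->; rewrite rmorphXn.
rewrite coefCM; congr (_ * _).
have -> : \prod_(i in D) (if i \in D then X i *: 'X else (ka i)%:P) ^+ m i
   = (\prod_(i in D) X i ^+ m i) *: 'X^(\sum_(i in D) m i).
  rewrite -prodrXr -scaler_prod; apply: eq_bigr => i ->.
  by rewrite exprZn.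
by rewrite coefZ coefXn mulrC eq_sym.
Qed.

Lemma wspan_spec ka h k :
  weight_span D o k (fun X => \sum_(s | perm_on (D :\ o) s) (specialize ka (fun i => X (s i)) h)`_k).
Proof.
apply: ws_ext (@ws_sum _ _ _ _ _ _ (msupp h) xpredT (fun m X =>
   h@_m * (\prod_(i | i \notin D) ka i ^+ m i) * ((\sum_(i in D) m i == k)%N%:R * orbit_sum D o m X)) _).
  move=> X; under [RHS]eq_bigr => s _ do rewrite spec_coef.
  rewrite exchange_big /=; apply: eq_bigr => m _.
  by rewrite /orbit_sum -!mulr_sumr.
move=> m _; apply: ws_scale.
case: eqP => [<-|_]; last by apply: ws_ext (@ws_zero _ _ D o k) => X; rewrite mul0r.
by apply: ws_scale; apply: orb_wspan.
Qed.

Definition dilate (ka X : 'I_n -> C) t i := if i \in D then t * X i else ka i.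

Lemma horner_spec ka X h t : (specialize ka X h).[t] = h.@[dilate ka X t].
Proof.
rewrite /specialize horner_mmap; apply: meval_eq => i; rewrite /dilate; case: ifP => _.
  by rewrite hornerZ hornerX mulrC.
by rewrite hornerC.
Qed.

(** Along [dilate] the right-hand side is [t ^ 5] times a power of [q] whose constant term depends
    neither on the values nor on the permutation. So the coefficient of [t ^ 5] in [h] is the
    section up to one nonzero constant; averaging over the permutations fixing [o] leaves the
    section unchanged and makes this coefficient a quintic in normal form. *)
Lemma no_extension (A0 B0 E0 : {set 'I_n}) (ka : 'I_n -> C) (q h : S) N :
  (0 < b)%N -> (0 < c)%N -> b != c -> three_blocks b c D A0 B0 E0 -> o \in A0 ->
  q.@[dilate ka (fun=> 0) 0] != 0 ->
  (forall s (z u v t : C), perm_on D s -> t != 0 -> ~ (z = u /\ z = v) ->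
     let X i := if s i \in A0 then z else if s i \in B0 then u else v in
     h.@[dilate ka X t] = q.@[dilate ka X t] ^+ N *
       section_val b c o [set i | s i \in A0] [set i | s i \in B0] (t * z) (t * u) (t * v)) ->
  False.
Proof.
move=> b0 c0 bc [eD [d1 d2 d3] [c1 c2 c3]] oA q0 hh.
pose X s (z u v : C) i := if (s : 'S_n) i \in A0 then z else if s i \in B0 then u else v.
pose F s z u v := section_val b c o [set i | (s : 'S_n) i \in A0] [set i | s i \in B0] z u v : C.
have coef5 s z u v : perm_on D s -> ~ (z = u /\ z = v) ->
    (specialize ka (X s z u v) h)`_5 = q.@[dilate ka (fun=> 0) 0] ^+ N * F s z u v.
  move=> hs ne; have -> : specialize ka (X s z u v) h = specialize ka (X s z u v) q ^+ N * (F s z u v *: 'X^5).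
    apply/eqP; rewrite -subr_eq0; apply/eqP; apply: poly_eq0_fun => t t0.
    rewrite hornerD hornerN hornerM horner_exp hornerZ hornerXn !horner_spec.
    rewrite hh // -mulrBr; apply/eqP; rewrite mulf_eq0 subr_eq0; apply/orP; right; apply/eqP.
    by rewrite /F /section_val /phi; case: ifP => _; [|case: ifP => _]; ring.
  rewrite -scalerAr coefZ coefMXn /= subnn mulrC; congr (_ * _).
  rewrite -horner_coef0 horner_exp horner_spec; congr (_ ^+ _); apply: meval_eq => i.
  by rewrite /dilate; case: ifP; rewrite ?mul0r.
have [cf hcf] := wspan_nf (wspan_spec ka h 5) (leqnn 5).
have FE s g z u v : perm_on (D :\ o) g -> F (g * s)%g z u v = F s z u v.
  by move=> hg; rewrite /F /section_val !inE permM (perm_on_o hg).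
pose K : C := #|[pred g : 'S_n | perm_on (D :\ o) g]|%:R * q.@[dilate ka (fun=> 0) 0] ^+ N.
have K0 : K != 0.
  rewrite mulf_neq0 ?expf_neq0 // pnatr_eq0 -lt0n; apply/card_gt0P; exists 1%g.
  by rewrite inE perm_on1.
have PwE s z u v k : perm_on D s ->
    power_sum D (X s z u v) k = (b%:R + c%:R) * z ^+ k + b%:R * u ^+ k + c%:R * v ^+ k.
  move=> hs; rewrite /power_sum -natrD -c1 -c2 -c3.
  pose Y i := if i \in A0 then z else if i \in B0 then u else v.
  have -> : \sum_(i in D) X s z u v i ^+ k = \sum_(i in D) Y i ^+ k.
    rewrite [RHS](reindex_inj (@perm_inj _ s)) /=; apply: eq_bigl => i.
    by rewrite (perm_closed i hs).
  have dABE := disjoint_setU d2 d3.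
  rewrite eD (eq_bigl [predU A0 :|: B0 & E0]) => [|i]; last by rewrite !inE.
  rewrite bigU //= (@sum_on2 _ _ A0 B0 (z ^+ k) (u ^+ k)) // => [|i iA|i iB].
  - congr (_ + _); apply: sum_on => i iE.
    by rewrite /Y (disjointFl d2 iE) (disjointFl d3 iE).
  - by rewrite /Y iA.
  - by rewrite /Y iB (disjointFl d1 iB).
have main s z u v : perm_on D s -> ~ (z = u /\ z = v) ->
    (b%:R + c%:R) * z + b%:R * u + c%:R * v = 0 ->
    normal_form 5 cf (X s z u v o) (power_sum D (X s z u v)) = K * F s z u v.
  move=> hs ne P1; rewrite -hcf; last by rewrite PwE // !expr1.
  rewrite (eq_bigr (fun=> q.@[dilate ka (fun=> 0) 0] ^+ N * F s z u v)) => [|g hg].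
    by rewrite sumr_const /K -mulrA mulr_natl.
  have hg' : perm_on D (g * s)%g.
    by apply: perm_onM => //; apply: subset_trans hg _; apply: subD1set.
  rewrite -(FE s g) // -coef5 // (@spec_ext ka _ (X (g * s)%g z u v)) // => i.
  by rewrite /X permM.
have [kB hkB] : exists k, k \in B0 by apply/card_gt0P; rewrite c2.
have [kE hkE] : exists k, k \in E0 by apply/card_gt0P; rewrite c3.
have onT k : k \in D -> perm_on D (tperm o k).
  move=> kD; apply/subsetP => i; rewrite inE.
  by case: tpermP => [->|->|_ _] //; rewrite eqxx.
have kBD : kB \in D by rewrite eD !inE hkB orbT.
have kED : kE \in D by rewrite eD !inE hkE orbT.
have bp : 0 < (b%:R : C) by rewrite ltr0n.
have cp : 0 < (c%:R : C) by rewrite ltr0n.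
have bcn : (b%:R : C) != c%:R by rewrite eqr_nat.
pose u t : C := - 1 + c%:R * t; pose v t : C := - 1 - b%:R * t.
have ne t : ~ (1 = u t /\ 1 = v t).
  case=> /eqP; rewrite -subr_eq0 => /eqP e1 /eqP; rewrite -subr_eq0 => /eqP e2.
  have : b%:R * (1 - u t) + c%:R * (1 - v t) = 2 * (b%:R + c%:R) by rewrite /u /v; ring.
  by rewrite e1 e2 !mulr0 addr0 => /esym /eqP; rewrite gt_eqF // mulr_gt0 ?addr_gt0 ?ltr0n.
have P1 t : (b%:R + c%:R) * 1 + b%:R * u t + c%:R * v t = 0 by rewrite /u /v; ring.
have fE t : phi 1 (u t) (v t) = (2 - c%:R * t) ^+ 2 * (2 + b%:R * t) ^+ 2 * ((b%:R + c%:R) * t).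
  by rewrite /phi /u /v; ring.
apply: (quintic_obstruction (q0 := cf 0%N) (q2 := cf 1%N) (q3 := cf 2) (q4 := cf 3) (q22 := cf 4)
  (q5 := cf 5) (q23 := cf 6) bp cp bcn K0) => t.
(* The identity keeps [o] in [A0]; in the other two cases a transposition moves it to [B0] or
   [E0]. *)
- have := main 1%g 1 (u t) (v t) (perm_on1 _) (ne t) (P1 t).
  rewrite /= /F /section_val !inE /X perm1 oA mulr0 /quintic => <-.
  by rewrite !(PwE 1%g) ?perm_on1.
- have := main (tperm o kB) 1 (u t) (v t) (onT _ kBD) (ne t) (P1 t).
  rewrite /= /F /section_val !inE /X tpermL hkB (disjointFl d1 hkB) fE /quintic => <-.
  by rewrite !(PwE (tperm o kB)) ?onT.
- have := main (tperm o kE) 1 (u t) (v t) (onT _ kED) (ne t) (P1 t).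
  rewrite /= /F /section_val !inE /X tpermL (disjointFl d3 hkE) (disjointFl d2 hkE) fE /quintic => <-.
  by rewrite !(PwE (tperm o kE)) ?onT.
Qed.
End NonExtension.

(** * Components of the arrangement *)

Section Arrangement.
Variables (C : numFieldType) (b c r s n : nat).
Hypotheses (b0 : (0 < b)%N) (c0 : (0 < c)%N) (bc : b != c) (r0 : (0 < r)%N) (s0 : (0 < s)%N).
Hypothesis nE : n = (b + c + r * b + s * c)%N.
Local Notation la := (lambda_bcrs b c r s).
Local Notation S := {mpoly C[n]}.
Local Notation X := (@X_lambda C n la).

Lemma sumn_la : sumn la = n.
Proof. by rewrite /= sumn_cat !sumn_nseq nE addnA (mulnC b) (mulnC c). Qed.

Lemma size_la : size la = (r + s).+1.
Proof. by rewrite /= size_cat !size_nseq. Qed.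

Lemma nth_la k : (k < (r + s).+1)%N ->
  nth 0%N la k = if k == 0%N then (b + c)%N else if (k <= r)%N then b else c.
Proof.
case: k => [//|k] hk /=; rewrite nth_cat size_nseq nth_nseq.
by case: ltnP => // hr; rewrite nth_nseq ifT //; lia.
Qed.

(* One block of each size is merged into the label [0]. *)
Definition merge_label k := if (k == 1%N) || (k == r.+1) then 0%N else k.
Definition merged_label (i : 'I_n) := merge_label (blk la i).
Definition merged_block := [set i : 'I_n | merged_label i == 0%N].
Definition big_block := [set i : 'I_n | blk la i == 0%N].
Definition mid_block := [set i : 'I_n | blk la i == 1%N].
Definition small_block := [set i : 'I_n | blk la i == r.+1].

Lemma blk_la_lt (i : 'I_n) : (blk la i < (r + s).+1)%N.
Proof. by rewrite -size_la; apply: blk_lt; rewrite sumn_la. Qed.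

Lemma card_la k : (k < (r + s).+1)%N ->
  #|[set i : 'I_n | blk la i == k]| = if k == 0%N then (b + c)%N else if (k <= r)%N then b else c.
Proof. by move=> hk; rewrite (card_blk _ (esym sumn_la)) nth_la. Qed.

Lemma tri0 : three_blocks b c merged_block big_block mid_block small_block.
Proof.
split.
- by apply/setP => i; rewrite !inE /merged_label /merge_label -orbA; case: (blk la i == 1%N); case: (blk la i == r.+1);
    rewrite ?orbT ?orbF.
- split; rewrite -setI_eq0; apply/eqP/setP => i; rewrite !inE; apply/negP => /andP[/eqP ->] //.
  by rewrite eqSS eq_sym (gtn_eqF r0).
- split; first by rewrite card_la.
    by rewrite card_la /= ?r0 //; lia.
  by rewrite card_la /= ?ltnn //; lia.
Qed.

Lemma om_lt i : (merged_label i < (r + s).+1)%N.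
Proof. by rewrite /merged_label /merge_label; case: ifP => // _; apply: blk_la_lt. Qed.

Lemma om_neq0 i : merged_label i != 0%N -> merged_label i = blk la i.
Proof. by rewrite /merged_label /merge_label; case: ifP. Qed.

Lemma om_label i : merged_label i != 1%N /\ merged_label i != r.+1.
Proof. by rewrite /merged_label /merge_label; case: ifP => // /negbT; rewrite negb_or => /andP[]. Qed.

Lemma ex_blk k : (k < (r + s).+1)%N -> exists i : 'I_n, blk la i = k.
Proof.
move=> hk; have [i hi] : exists i, i \in [set i : 'I_n | blk la i == k].
  by apply/card_gt0P; rewrite card_la //; case: ifP => _; [|case: ifP => _]; lia.
by exists i; apply/eqP; move: hi; rewrite inE.
Qed.

Lemma ex_om k : (k < (r + s).+1)%N -> k != 1%N -> k != r.+1 -> exists i, merged_label i = k.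
Proof.
move=> hk k1 k2; have [i hi] := ex_blk hk; exists i.
by rewrite /merged_label /merge_label hi (negbTE k1) (negbTE k2).
Qed.

Definition const_outside (x : 'I_n -> C) := forall i j, merged_label i = merged_label j -> merged_label i != 0%N -> x i = x j.

Definition sepq : S := \prod_(i < n) \prod_(j < n | merged_label i != merged_label j) ('X_i - 'X_j).

Lemma meval_sepq x : sepq.@[x] = \prod_(i < n) \prod_(j < n | merged_label i != merged_label j) (x i - x j).
Proof.
rewrite /sepq rmorph_prod; apply: eq_bigr => i _; rewrite rmorph_prod.
by apply: eq_bigr => j _ /=; rewrite mevalB !mevalXU.
Qed.

Lemma sepq_neq x i j : sepq.@[x] != 0 -> x i = x j -> merged_label i = merged_label j.
Proof.
rewrite meval_sepq => /prodf_neq0/(_ i isT)/prodf_neq0/(_ j) h e.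
by apply/eqP/negPn/negP => /h; rewrite e subrr eqxx.
Qed.

(* Off the zero set of [sepq] every component refines the fibres of [merged_label], and its [r + s + 1]
   blocks can only be distributed three to [merged_block] and one to each other fibre. *)
Lemma X_lambda_local x : X x -> sepq.@[x] != 0 ->
  const_outside x /\ exists A B E z u v,
    [/\ three_blocks b c merged_block A B E, const_on x A z, const_on x B u & const_on x E v].
Proof.
move=> [sg [y [Ey xE]]] nz.
pose K := (r + s).+1.
pose g (i : 'I_n) : 'I_K := Ordinal (blk_la_lt (sg i)).
have gx i j : g i = g j -> x i = x j.
  by move=> /(congr1 val) /= e; rewrite !xE; apply: Ey.
have gom i j : g i = g j -> merged_label i = merged_label j by move=> /gx; apply: sepq_neq.
pose sz (k : nat) := if k == 0%N then (b + c)%N else if (k <= r)%N then b else c.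
have cg (k : 'I_K) : #|[set i | g i == k]| = sz k.
  rewrite -[RHS]card_la ?ltn_ord // -[RHS](card_preimset _ (@perm_inj _ sg)).
  by apply: eq_card => i; rewrite inE [RHS]inE inE.
have ex_g (k : 'I_K) : exists i, g i == k.
  have [i hi] : exists i, i \in [set i | g i == k].
    by apply/card_gt0P; rewrite cg /sz; case: ifP => _; [|case: ifP => _]; lia.
  by exists i; move: hi; rewrite inE.
pose rp k := xchoose (ex_g k).
have rpE k : g (rp k) = k by apply/eqP/(xchooseP (ex_g k)).
pose psi k : 'I_K := Ordinal (om_lt (rp k)).
have psiE i : val (psi (g i)) = merged_label i by rewrite /psi /=; apply: gom; rewrite rpE.
pose L0 := [set k | psi k == ord0].
have inL0 i : (g i \in L0) = (i \in merged_block) by rewrite !inE -val_eqE psiE.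
have cD : #|merged_block| = (\sum_(k in L0) sz k)%N.
  rewrite -sum1_card (partition_big g (fun k => k \in L0)) => [|i]; last by rewrite inL0.
  apply: eq_bigr => k kL; rewrite -cg -sum1_card; apply: eq_bigl => i; rewrite !inE.
  by apply/andP/idP => [[]//|/eqP e]; split; last exact/eqP; move: kL; rewrite -e inL0 inE.
have cD' : #|merged_block| = (b + c + b + c)%N.
  case: tri0 => -> [d1 d2 d3] [c1 c2 c3].
  by rewrite !card_disjU ?c1 ?c2 ?c3 //; apply: disjoint_setU.
(* Two blocks have at most [2 * maxn b c + minn b c] coordinates in total, since only one has size
   [b + c]; the merged block has [2 * b + 2 * c]. *)
have L03 : (2 < #|L0|)%N.
  rewrite ltnNge; apply/negP => le2.
  have : (\sum_(k in L0) sz k <= \sum_(k in L0) maxn b c + \sum_(k in L0) (k == ord0) * minn b c)%N.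
    rewrite -big_split /=; apply: leq_sum => k _; rewrite /sz -[k == ord0]val_eqE /=.
    by case: ifP => _; [|case: ifP => _]; lia.
  rewrite sum_nat_const -big_distrl /=.
  have : (\sum_(k in L0) (k == ord0) <= 1)%N.
    rewrite (eq_bigr (fun k => if k == ord0 then 1 else 0)%N) => [|k _]; last by case: eqP.
    rewrite -big_mkcondr sum1dep_card -(cards1 (ord0 : 'I_K)); apply: subset_leq_card.
    by apply/subsetP => k; rewrite !inE => /andP[].
  rewrite -cD cD'; move: le2; move: #|L0| (\sum_(k in L0) _)%N => l e h1 h2.
  have : (l * maxn b c <= 2 * maxn b c)%N by rewrite leq_mul2r h1 orbT.
  have : (e * minn b c <= 1 * minn b c)%N by rewrite leq_mul2r h2 orbT.
  lia.
(* Each of the remaining [r + s - 2] labels needs a block outside [L0]. With [L03] this leaves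
   exactly three blocks in [L0] and makes [psi] injective on the others. *)
pose K' := [set k : 'I_K | [&& k != 0%N :> nat, k != 1%N :> nat & k != r.+1 :> nat]].
have cK' : (#|K'| + 3)%N = K.
  have h1 : (1 < K)%N by rewrite /K; lia.
  have h2 : (r.+1 < K)%N by rewrite /K; lia.
  pose o1 := Ordinal h1; pose o2 := Ordinal h2.
  have -> : K' = ~: [set ord0; o1; o2].
    by apply/setP => k; rewrite !inE !negb_or -!val_eqE /= andbA.
  have <- : #|[set ord0; o1; o2]| = 3%N.
    rewrite setUC cardsU1 !inE cards2 -!val_eqE /=.
    by rewrite eqSS (gtn_eqF r0).
  by rewrite addnC cardsC card_ord.
have sub : K' \subset psi @: ~: L0.
  apply/subsetP => k; rewrite inE => /and3P[k0 k1 k2].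
  have [i hi] := ex_om (ltn_ord k) k1 k2.
  apply/imsetP; exists (g i); last by apply: val_inj; rewrite psiE hi.
  by rewrite inE inL0 inE hi.
have cL : (#|L0| + #|~: L0|)%N = K by rewrite cardsC card_ord.
have le1 := subset_leq_card sub.
have le2 := leq_imset_card psi (~: L0).
have cL0 : #|L0| = 3%N by lia.
have /imset_injP inj : #|psi @: ~: L0| == #|~: L0| by apply/eqP; lia.
have g_inj i j : merged_label i = merged_label j -> merged_label i != 0%N -> g i = g j.
  move=> e ne; apply: inj; rewrite ?inE -?val_eqE ?psiE -?e //.
  by apply: val_inj; rewrite !psiE.
split; first by move=> i j e ne; apply: gx; apply: g_inj.
(* Otherwise the block of size [b + c] would fill a fibre of size [b] or [c]. *)
have z0 : ord0 \in L0.
  apply/negPn/negP => nz0; pose k := psi ord0.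
  have [i hi] : exists i, g i == ord0 by apply: ex_g.
  have omi : merged_label i = k by rewrite -psiE (eqP hi).
  have k0 : (k : nat) != 0%N by move: nz0; rewrite inE -val_eqE.
  have : #|[set j | g j == ord0]| = #|[set j : 'I_n | blk la j == k]|.
    apply: eq_card => j; rewrite !inE; apply/eqP/eqP => [e|e].
      have omj : merged_label j = k by rewrite -psiE e.
      by rewrite -om_neq0 ?omj.
    have omj : merged_label j = k.
      have [k1 k2] := om_label i; rewrite omi in k1 k2.
      by rewrite /merged_label /merge_label e (negbTE k1) (negbTE k2).
    by rewrite -(eqP hi); apply/esym/g_inj; rewrite omi ?omj.
  rewrite cg card_la ?ltn_ord // /sz eqxx (negbTE k0); case: ifP => _; lia.
have c2 : #|L0 :\ ord0| == 2%N.
  by have := cardsD1 ord0 L0; rewrite z0 cL0 add1n => -[<-].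
have [k1 [k2 [ne12 eL]]] := elimT (cards2P _) c2.
have sum12 : (sz k1 + sz k2)%N = (b + c)%N.
  have := cD; rewrite cD' (big_setD1 ord0) //= eL big_setU1 ?inE //= big_set1.
  rewrite {1}/sz eqxx; lia.
have kn0 k : k \in L0 :\ ord0 -> (k : nat) != 0%N by rewrite !inE -val_eqE => /andP[].
wlog sz1 : k1 k2 ne12 eL sum12 / sz k1 = b.
  move=> wl; have k1n : (k1 : nat) != 0%N by apply: kn0; rewrite eL !inE eqxx.
  have k2n : (k2 : nat) != 0%N by apply: kn0; rewrite eL !inE eqxx orbT.
  have [e|e] : sz k1 = b \/ sz k1 = c by rewrite /sz (negbTE k1n); case: ifP; [left|right].
    exact: (wl k1 k2).
  by apply: (wl k2 k1); rewrite 1?eq_sym 1?setUC //; lia.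
have sz2 : sz k2 = c by lia.
have L0E k : (k \in L0) = (k == ord0) || (k == k1) || (k == k2).
  by rewrite -(setD1K z0) eL !inE orbA.
have n1 : k1 != ord0 by move: (kn0 k1); rewrite eL !inE eqxx -val_eqE => ->.
have n2 : k2 != ord0 by move: (kn0 k2); rewrite eL !inE eqxx orbT -val_eqE => ->.
exists [set i | g i == ord0], [set i | g i == k1], [set i | g i == k2], (x (rp ord0)), (x (rp k1)), (x (rp k2)).
have onk k : const_on x [set i | g i == k] (x (rp k)).
  by move=> i; rewrite inE => /eqP e; apply: gx; rewrite rpE.
have dis k k' : k != k' -> [disjoint [set i | g i == k] & [set i | g i == k']].
  move=> ne; rewrite -setI_eq0; apply/eqP/setP => i; rewrite !inE.
  by apply/negP => /andP [/eqP e1 /eqP e2]; move: ne; rewrite -e1 -e2 eqxx.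
split=> //; split.
- by apply/setP => i; rewrite -inL0 L0E !inE.
- by split; apply: dis; rewrite // eq_sym.
- by rewrite !cg sz1 sz2.
Qed.

End Arrangement.

(** * The ideal of multipliers and the contradiction *)

Section Saturation.
Variable S : comNzRingType.
Implicit Types (J : S -> Prop) (ls : seq S).

(** Starting from 1, multiply by each [l] in turn to the largest power that stays outside [J]. *)
Lemma maximal_outside J ls : ideal_like J -> ~ J 1 ->
  (forall l, l \in ls -> exists N, J (l ^+ N)) ->
  exists2 m, ~ J m & forall l, l \in ls -> J (l * m).
Proof.
move=> [J0 JD JM] J1; elim: ls => [|l ls IH] hl; first by exists 1.
have [l' hl'|m0 nJ hm] := IH; first by apply: hl; rewrite inE hl' orbT.
have [N JN] := hl l (mem_head _ _).
have [k nk Jk] : exists2 k, ~ J (l ^+ k * m0) & J (l ^+ k.+1 * m0).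
  have : J (l ^+ N * m0) by rewrite mulrC; apply: JM.
  elim: N {JN} => [|N IHN] h; first by rewrite expr0 mul1r in h.
  by have [/IHN//|h'] := classic (J (l ^+ N * m0)); exists N.
exists (l ^+ k * m0) => // l'; rewrite inE => /orP[/eqP ->|hl']; first by rewrite mulrA -exprS.
by rewrite mulrCA; apply: JM; apply: hm.
Qed.

Lemma choice_in ls (Q : S -> S -> Prop) : (forall l, l \in ls -> exists h, Q l h) ->
  exists g : S -> S, forall l, l \in ls -> Q l (g l).
Proof.
elim: ls => [|l ls IH] hl; first by exists id.
have [l' hl'|g hg] := IH; first by apply: hl; rewrite inE hl' orbT.
have [h Qh] := hl l (mem_head _ _).
exists (fun x => if x == l then h else g x) => l'; rewrite inE.
by case: eqP => [-> //|_] /= hl'; apply: hg.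
Qed.

End Saturation.

Section Main.
Variables (C : numFieldType) (b c r s n : nat).
Hypotheses (b0 : (0 < b)%N) (c0 : (0 < c)%N) (bc : b != c) (r0 : (0 < r)%N) (s0 : (0 < s)%N).
Hypothesis nE : n = (b + c + r * b + s * c)%N.
Local Notation la := (lambda_bcrs b c r s).
Local Notation S := {mpoly C[n]}.
Local Notation X := (@X_lambda C n la).
Local Notation om := (@merged_label b c r s n).
Local Notation D0 := (@merged_block b c r s n).
Local Notation A0 := (@big_block b c r s n).
Local Notation B0 := (@mid_block b c r s n).
Local Notation E0 := (@small_block b c r s n).
Local Notation outer := (@const_outside C b c r s n).
Local Notation sepq := (@sepq C b c r s n).

Definition point x A B E z u v :=
  [/\ X x, outer x, three_blocks b c D0 A B E & [/\ const_on x A z, const_on x B u & const_on x E v]].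

Variables (rep : nat -> 'I_n) (o : 'I_n).
Hypothesis repE : forall k, (k < (r + s).+1)%N -> blk la (rep k) = k.
Hypothesis oA : o \in A0.

Definition labels := [seq k <- iota 0 (r + s).+1 | (k != 1%N) && (k != r.+1)].
(** Coordinates along [W]; [block_diffs] are linear equations of [W], and the two together generate
    all variables. *)
Definition block_coords : seq S := [seq 'X_(rep k) | k <- labels].
Definition block_diffs : seq S := [seq 'X_i - 'X_(rep (om i)) | i <- enum 'I_n].

(* The functions [m] for which [m] times the section [section_val] extends to the ambient space,
   after localization at [sepq] and off the common zeros of [block_diffs]. *)
Definition ext_ideal (m : S) := exists k (h : S), forall x A B E z u v,
  point x A B E z u v -> forall l, l \in block_diffs ->
  l.@[x] * h.@[x] = l.@[x] * (sepq.@[x] ^+ k * (m.@[x] * section_val b c o A B z u v)).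

Lemma labelsP k : k \in labels -> [/\ (k < (r + s).+1)%N, k != 1%N & k != r.+1].
Proof. by rewrite mem_filter mem_iota add0n => /andP [/andP [k1 k2] hk]. Qed.

Lemma om_labels i : om i \in labels.
Proof.
have [h1 h2] := om_label b c r s i.
by rewrite mem_filter h1 h2 mem_iota add0n (om_lt nE).
Qed.

Lemma om_rep k : k \in labels -> om (rep k) = k.
Proof.
by case/labelsP => hk k1 k2; rewrite /merged_label /merge_label repE // (negbTE k1) (negbTE k2).
Qed.

(** This is where codimension 2 enters: [W] has [r + s - 1] free values, an irreducible component of
    [X_lambda] has [r + s + 1]. *)
Lemma size_ts : (size block_coords + 2)%N = (r + s).+1.
Proof.
rewrite size_map size_filter; set L := iota _ _; set P := fun k => _.
have <- : count (predC P) L = 2%N; last by rewrite count_predC size_iota.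
have := count_predUI (pred1 1%N) (pred1 r.+1) L.
have -> : count (predI (pred1 1%N) (pred1 r.+1)) L = 0%N.
  transitivity (count pred0 L); last exact: count_pred0.
  apply: eq_count => k /=; apply/negP => /andP [/eqP -> /eqP [e]].
  by move: r0; rewrite -e.
rewrite addn0 !count_uniq_mem ?iota_uniq // !mem_iota.
have -> : (0 <= 1 < 0 + (r + s).+1)%N by lia.
have -> : (0 <= r.+1 < 0 + (r + s).+1)%N by lia.
move=> h; transitivity (count (predU (pred1 1%N) (pred1 r.+1)) L); last exact: h.
by apply: eq_count => k; rewrite /= negb_and !negbK.
Qed.

Lemma ext_ideal_like : ideal_like ext_ideal.
Proof.
split.
- by exists 0%N, 0 => x A B E z u v _ l _; rewrite !meval0 mul0r !mulr0.
- move=> m m' [k [h hh]] [k' [h' hh']].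
  exists (k + k')%N, (sepq ^+ k' * h + sepq ^+ k * h') => x A B E z u v pt l hl.
  rewrite !mevalD !mevalM !rmorphXn /= exprD.
  transitivity (sepq.@[x] ^+ k' * (l.@[x] * h.@[x]) + sepq.@[x] ^+ k * (l.@[x] * h'.@[x])); first by ring.
  by rewrite (hh _ _ _ _ _ _ _ pt) // (hh' _ _ _ _ _ _ _ pt) //; ring.
- move=> a m [k [h hh]]; exists k, (a * h) => x A B E z u v pt l hl.
  rewrite !mevalM; transitivity (a.@[x] * (l.@[x] * h.@[x])); first by ring.
  by rewrite (hh _ _ _ _ _ _ _ pt) //; ring.
Qed.

Lemma ext_ideal_eq m m' : (forall x A B E z u v, point x A B E z u v -> m.@[x] = m'.@[x]) ->
  ext_ideal m -> ext_ideal m'.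
Proof.
move=> e [k [h hh]]; exists k, h => x A B E z u v pt l hl.
by rewrite -(e _ _ _ _ _ _ _ pt); apply: (hh _ _ _ _ _ _ _ pt).
Qed.

Lemma oD : o \in D0.
Proof. by case: (tri0 b0 c0 bc r0 s0 nE) => -> _ _; rewrite inE (in_setU _ A0) oA. Qed.

Lemma cardD0 : #|D0| = (b + c + b + c)%N.
Proof.
case: (tri0 b0 c0 bc r0 s0 nE) => -> [d1 d2 d3] [c1 c2 c3].
by rewrite !card_disjU ?c1 ?c2 ?c3 //; apply: disjoint_setU.
Qed.

Lemma ext_ideal_sep U V : D0 = U :|: V -> [disjoint U & V] ->
  [\/ #|V| = b, #|V| = c | #|V| = (b + c)%N] -> ext_ideal (sepX C U V).
Proof.
move=> eD dUV hV; have [g hg] := sep_local C b0 c0 bc cardD0 eD dUV oD hV.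
exists 0%N, (sepX C U V * g) => x A B E z u v [_ _ ht [hA hB hE]] l _.
by rewrite expr0 mul1r (hg _ _ _ _ _ _ _ ht hA hB hE) mevalM.
Qed.

(** Outside the merged block the difference vanishes at every [point]; inside it, the products
    [sepX] in the ideal produce a power of the difference. *)
Lemma ext_ideal_pow l : l \in block_diffs -> exists N, ext_ideal (l ^+ N).
Proof.
case/mapP => i _ ->; have hrep := om_rep (om_labels i).
have [oi|oi] := eqVneq (om i) 0%N; last first.
  exists 1%N; apply: (@ext_ideal_eq 0); last by case: ext_ideal_like.
  move=> x A B E z u v [_ ho _ _]; rewrite expr1 meval0 mevalB !mevalXU.
  by rewrite (ho i (rep (om i))) ?subrr ?hrep.
have iD : i \in D0 by rewrite inE oi.
have jD : rep (om i) \in D0 by rewrite inE hrep oi.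
have [N [a Ja ha]] := pow_in_all ext_ideal_like b0 c0 iD jD ext_ideal_sep.
exists N; apply: ext_ideal_eq Ja => x A B E z u v [_ _ ht [hA hB hE]].
by rewrite rmorphXn /= mevalB !mevalXU (ha _ _ _ _ _ _ _ ht hA hB hE).
Qed.

Lemma ext_ideal_proper : ~ ext_ideal 1.
Proof.
case=> N [h hh]; have ht0 := tri0 b0 c0 bc r0 s0 nE.
have [eD [d1 d2 d3] [c1 c2 c3]] := ht0.
(* Taking labels as values gives a point of [W] with distinct values on distinct fibres, so [sepq]
   is nonzero there; the value 0 on the merged block is the limit [t = 0] of the dilation. *)
apply: (@no_extension C n D0 o b c oD A0 B0 E0 (fun i => (om i)%:R) sepq h N) => //.
  rewrite meval_sepq; apply/prodf_neq0 => i _; apply/prodf_neq0 => j hij.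
  have E k : dilate D0 (fun i => (om i)%:R) (fun=> 0) 0 k = (om k)%:R :> C.
    by rewrite /dilate inE; case: eqP => [->|]; rewrite ?mul0r.
  by rewrite !E subr_eq0 eqr_nat.
move=> g z u v t hg t0 ne Y; set x := dilate _ _ _ _.
pose A := [set i | g i \in A0]; pose B := [set i | g i \in B0]; pose E := [set i | g i \in E0].
have gD i : (g i \in D0) = (i \in D0) := perm_closed i hg.
have xY i : i \in D0 -> x i = t * Y i by rewrite /x /dilate => ->.
have ht : three_blocks b c D0 A B E.
  split.
  - by apply/setP => i; rewrite -gD {1}eD !inE.
  - have dis (P Q : {set 'I_n}) : [disjoint P & Q] -> [disjoint [set i | g i \in P] & [set i | g i \in Q]].
      move=> d; rewrite -setI_eq0; apply/eqP/setP => i; rewrite !inE.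
      by apply/negP => /andP [hP]; rewrite (disjointFr d hP).
    by split; apply: dis.
  - have cd (P : {set 'I_n}) : #|[set i | g i \in P]| = #|P|.
      rewrite -(card_preimset P (@perm_inj _ g)); apply: eq_card => i; by rewrite !inE.
    by rewrite !cd.
have inD (P : {set 'I_n}) i : P \subset D0 -> g i \in P -> i \in D0.
  by move=> sP gP; rewrite -gD; apply: (subsetP sP).
have sA : A0 \subset D0 by rewrite eD -setUA subsetUl.
have sB : B0 \subset D0 by rewrite eD setUAC subsetUr.
have sE : E0 \subset D0 by rewrite eD subsetUr.
have hA : const_on x A (t * z) by move=> i; rewrite inE => iA; rewrite xY /Y ?iA // (inD A0).
have hB : const_on x B (t * u).
  by move=> i; rewrite inE => iB; rewrite xY /Y ?(disjointFl d1 iB) ?iB // (inD B0).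
have hE : const_on x E (t * v).
  by move=> i; rewrite inE => iE; rewrite xY /Y ?(disjointFl d2 iE) ?(disjointFl d3 iE) // (inD E0).
have pt : point x A B E (t * z) (t * u) (t * v).
  split=> //.
  - exists g, (fun i => if i \in D0 then t * (if i \in A0 then z else if i \in B0 then u else v)
                     else (blk la i)%:R); split=> [i j e|i].
      by rewrite !inE /merged_label e.
    rewrite /x /dilate gD; case: ifP => // iD.
    have -> : g i = i by apply: (out_perm hg); rewrite iD.
    by rewrite om_neq0 //; move: iD; rewrite inE => ->.
  - by move=> i j e ni; rewrite /x /dilate !inE -e (negbTE ni).
have [l hl lx] : exists2 l, l \in block_diffs & l.@[x] != 0.
  apply: NNPP => no; apply: ne.
  have same i : i \in D0 -> x i = x (rep 0%N).
    move=> iD; apply/eqP/negPn/negP => ni; apply: no.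
    exists ('X_i - 'X_(rep (om i))); first by apply: map_f; rewrite mem_enum.
    by move: iD; rewrite inE mevalB !mevalXU subr_eq0 => /eqP ->.
  have [_ [_ _ _] [cA cB cE]] := ht; have [eD' _ _] := ht.
  have [kA hkA] : exists k, k \in A by apply/card_gt0P; rewrite cA; lia.
  have [kB hkB] : exists k, k \in B by apply/card_gt0P; rewrite cB.
  have [kE hkE] : exists k, k \in E by apply/card_gt0P; rewrite cE.
  have eA : x (rep 0%N) = t * z by rewrite -(hA kA hkA) same // eD' !in_setU hkA.
  have eB : x (rep 0%N) = t * u by rewrite -(hB kB hkB) same // eD' !in_setU hkB orbT.
  have eE : x (rep 0%N) = t * v by rewrite -(hE kE hkE) same // eD' !in_setU hkE orbT.
  by split; apply: (mulfI t0); rewrite -eA.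
by have := hh _ _ _ _ _ _ _ pt l hl; rewrite meval1 mul1r => /(mulfI lx).
Qed.

Lemma X_lambda_bcrs_not_CM : ~ arrangement_CM X.
Proof.
case=> d [[_ dmax] [fs [szfs [irr reg]]]].
have dge : ((r + s).+1 <= d)%N.
  apply: dmax; rewrite -(size_la b c r s); apply: chain_above_X_lambda.
    by rewrite (sumn_la nE).
  by rewrite /= all_cat !all_nseq b0 c0 !orbT /=; lia.
have [m nJm hm] := maximal_outside ext_ideal_like ext_ideal_proper ext_ideal_pow.
(* A single exponent of [sepq] must serve all [l], for the extensions to form one cocycle. *)
have aux (L : seq S) : {subset L <= block_diffs} -> exists k, forall l, l \in L -> exists h : S,
    forall x A B E z u v, point x A B E z u v -> forall l', l' \in block_diffs ->
    l'.@[x] * h.@[x] = l'.@[x] * (sepq.@[x] ^+ k * ((l * m).@[x] * section_val b c o A B z u v)).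
  elim: L => [|l L IH] hL; first by exists 0%N.
  have [l' hl'|k hk] := IH; first by apply: hL; rewrite inE hl' orbT.
  have [k' [h' hh']] := hm l (hL l (mem_head _ _)).
  exists (k + k')%N => l1; rewrite inE => /orP[/eqP ->|hl1].
    exists (sepq ^+ k * h') => x A B E z u v pt l' hl'.
    by rewrite [(sepq ^+ k * h').@[x]]mevalM rmorphXn /= mulrCA (hh' _ _ _ _ _ _ _ pt l' hl') exprD; ring.
  have [h1 hh1] := hk l1 hl1; exists (sepq ^+ k' * h1) => x A B E z u v pt l' hl'.
  by rewrite [(sepq ^+ k' * h1).@[x]]mevalM rmorphXn /= mulrCA (hh1 _ _ _ _ _ _ _ pt l' hl') exprD; ring.
have [k hk] := aux block_diffs (fun l h => h).
have [g hg] := choice_in hk.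
(* The relations between the [g l] are available on [X] where [sepq] is nonzero; the extra factor
   [sepq] makes them hold on all of [X] and accounts for the exponent [k.+1] below. *)
have [||||||||h hh] := @depth_extension C n (vanishing_ideal X) fs block_coords block_diffs (fun l => sepq * g l).
- exact: vanishing_is_ideal.
- by apply: vanishing_homog => t x; apply: X_lambda_scale.
- exact: irr.
- exact: reg.
- by rewrite size_ts szfs.
- move=> y; rewrite mem_cat => /orP[] /mapP[i _ ->]; last apply: rpredB; by rewrite dhomogX /= mdeg1.
- move=> i; exists 'X_(rep (om i)), ('X_i - 'X_(rep (om i))); split.
  + by apply/mapP; exists (om i) => //; apply: om_labels.
  + by apply: map_f; rewrite mem_enum.
  + by rewrite addrC subrK.
- move=> l l' hl hl' x Xx; rewrite mevalB !mevalM.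
  have [->|nz] := eqVneq sepq.@[x] 0; first by rewrite !mul0r !mulr0 subrr.
  have [ho [A [B [E [z [u [v [ht hA hB hE]]]]]]]] := X_lambda_local b0 c0 bc r0 s0 nE Xx nz.
  have pt : point x A B E z u v by split.
  rewrite mulrCA (hg l' hl' _ _ _ _ _ _ _ pt l hl) (mulrCA l'.@[x]).
  by rewrite (hg l hl _ _ _ _ _ _ _ pt l' hl') !mevalM; ring.
apply: nJm; exists k.+1, h => x A B E z u v pt l hl.
have [Xx _ _ _] := pt.
have [->|nl] := eqVneq l.@[x] 0; first by rewrite !mul0r.
have /eqP := hh l hl x Xx; rewrite mevalB !mevalM subr_eq0 => /eqP <-.
have /(mulfI nl) -> := hg l hl _ _ _ _ _ _ _ pt l hl.
by rewrite mevalM exprS; ring.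
Qed.

End Main.

Theorem theorem7p2 (R : realType) (b c r s : nat) :
  (0 < c)%N -> (c < b)%N -> (0 < r)%N -> (0 < s)%N ->
  ~ arrangement_CM
      (X_lambda (C := R[i]) (n := (b + c + r * b + s * c)%N) (lambda_bcrs b c r s)).
Proof.
move=> c0 cb r0 s0; have b0 : (0 < b)%N by apply: leq_trans cb.
have bc : b != c by rewrite gtn_eqF.
have nE := erefl (b + c + r * b + s * c)%N.
have [o ho] := ex_blk b0 c0 bc r0 s0 nE (ltn0Sn (r + s)).
pose rep k := odflt o [pick i : 'I_(b + c + r * b + s * c)%N | blk (lambda_bcrs b c r s) i == k].
apply: (@X_lambda_bcrs_not_CM _ b c r s _ b0 c0 bc r0 s0 nE rep o).
  move=> k hk; rewrite /rep; case: pickP => [i /eqP //|no].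
  by have [i hi] := ex_blk b0 c0 bc r0 s0 nE hk; have := no i; rewrite hi eqxx.
by rewrite inE ho.
Qed.
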